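(* Let $c_j:=\mu_1\left(\frac{1}{\mu_{j-1}}-\frac{1}{\mu_j}\right)$ for $j\ge2$, so that $c_2=1-\frac{\mu_1}{\mu_2}$ and $\sum_{j=2}^{k}c_j=1-\frac{\mu_1}{\mu_k}$. For all $u\in\mathcal{D}$ and all $m\ge2$, we have the exact identities $$\text{(I)}\quad \delta(u)=\sum_{j=2}^{m}(\mu_j-\mu_{j-1})\,d_2(u,\mathcal{M}_{j-1})^2+\sum_{k\ge m+1}(\mu_k-\mu_m)\|u_k\|_2^2,$$ $$\text{(II)}\quad \delta(u)=\sum_{j=2}^{m}c_j\,d_{\mathcal{E}}(u,\mathcal{M}_{j-1})^2+\frac{\mu_1}{\mu_m}\sum_{k\ge m+1}(\mu_k-\mu_m)\|u_k\|_2^2.$$ Consequently, $$\delta(u)=\sum_{j=2}^{\infty}(\mu_j-\mu_{j-1})\,d_2(u,\mathcal{M}_{j-1})^2=\mu_1\sum_{j=2}^{\infty}\left(\frac{1}{\mu_{j-1}}-\frac{1}{\mu_j}\right)d_{\mathcal{E}}(u,\mathcal{M}_{j-1})^2,$$ where both series are convergent, with nondecreasing partial sums. Moreover, in (I) and (II) the remainders (the sums over $k\ge m+1$, with the factor $\frac{\mu_1}{\mu_m}$ in (II)) are nonnegative, they vanish if and only if $u\in\mathcal{M}_m$, and the last coefficients $\mu_m-\mu_{m-1}$ and $c_m$ cannot be replaced by any larger constants in the inequalities, valid for all $u\in\mathcal{D}$, obtained from (I) and (II) by dropping the remainders.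
   Context: $\mu$ is a finite positive measure on a set $X$ and $A\ge0$ is a self-adjoint operator on $L^2(\mu)$ with compact resolvent. Its distinct eigenvalues are $0=\mu_0<\mu_1<\mu_2<\cdots$ with $\mu_k\to\infty$; $E_k$ is the (finite-dimensional) eigenspace of $\mu_k$, and $E_0$ is assumed to be the space of constant functions. $\mathcal{E}(u)=\langle Au,u\rangle$ is the associated quadratic form, defined on its form domain $\mathcal{D}$. $\|\cdot\|_2$ is the norm of $L^2(\mu)$. For $u\in\mathcal{D}$, $\bar u$ is the orthogonal projection of $u$ onto $E_0$, $\operatorname{Var}_\mu(u)=\|u-\bar u\|_2^2$, and $u-\bar u=\sum_{k\ge1}u_k$ with $u_k\in E_k$ the orthogonal projection of $u$ onto $E_k$. Set $$\delta(u)=\mathcal{E}(u)-\mu_1\operatorname{Var}_\mu(u),\qquad \mathcal{M}_m=E_0\oplus E_1\oplus\cdots\oplus E_m,$$ $$d_2(u,\mathcal{M}_m)^2=\inf_{\Phi\in\mathcal{M}_m}\|u-\Phi\|_2^2,\qquad d_{\mathcal{E}}(u,\mathcal{M}_m)^2=\inf_{\Phi\in\mathcal{M}_m}\mathcal{E}(u-\Phi).$$ *)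

(* Defs.v *)
From HB Require Import structures.
From mathcomp Require Import all_boot all_order all_algebra.
From mathcomp Require Import all_classical all_reals all_analysis.
From mathcomp Require Import measurable_realfun ess_sup_inf.

Set Implicit Arguments.
Unset Strict Implicit.
Unset Printing Implicit Defensive.

Import Order.TTheory GRing.Theory Num.Theory.
Import numFieldNormedType.Exports.

Local Open Scope classical_set_scope.
Local Open Scope ring_scope.

(* MathComp-Analysis provides [LspaceType mu p1], the type of p-th power
   integrable functions modulo almost everywhere equality, without algebraic
   structure.  This section makes it a vector space, the operations being
   computed on representatives. *)
Section Lspace_lmodule.
Context d (T : measurableType d) (R : realType).
Variables (mu : {measure set T -> \bar R}) (p : \bar R) (p1 : (1 <= p)%E).

Lemma ae_eq_Lnorm (f g : T -> R) :
  measurable_fun setT f -> measurable_fun setT g -> f = g %[ae mu] ->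
  'N[mu]_p[EFin \o f]%E = 'N[mu]_p[EFin \o g]%E.
Proof.
move=> mf mg fg; case: p p1 => [r| |] // _; rewrite unlock.
- pose k (h : T -> R) x : \bar R := (`|(EFin \o h) x| `^ r)%E.
  have mr (h : T -> R) : measurable_fun setT h -> measurable_fun setT (k h).
    move=> mh; apply: (measurableT_comp (measurable_poweR _)) => //.
    by apply: measurableT_comp => //; exact/measurable_EFinP.
  apply: (congr1 (poweR^~ r^-1)).
  apply: (ge0_ae_eq_integral _ (mr f mf) (mr g mg)) => //.
  + by move=> x _; exact: poweR_ge0.
  + by move=> x _; exact: poweR_ge0.
  + by apply: filterS fg => x /(_ I) fgx _; rewrite /k /= fgx.
- case: ifPn => // _.
  by apply: eq_ess_sup; apply: filterS fg => x /= ->.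
Qed.

(* [LspaceType] is built on functions valued in [measurableTypeR R], [LfunType]
   on functions valued in [R] with its canonical measurable structure; the
   sigma-algebras coincide. *)
Lemma Lspace_in_Lfun (F : LspaceType mu p1) : (F : T -> R) \in Lfun mu p.
Proof.
rewrite inE; apply/andP; split; rewrite inE /=.
  exact: (@measurable_funP _ _ _ _ setT
    (repr (F : {mfun_ mu, T >-> measurableTypeR R}))).
exact: (@Lebesgue_finite _ _ _ _ _ _ F).
Qed.

Definition Lspace_repr (F : LspaceType mu p1) : LfunType mu p1 :=
  Lfun_Sub p1 (Lspace_in_Lfun F).

Section class_of_function.
Variable f : LfunType mu p1.

Let g : T -> measurableTypeR R := f.

Let measurable_g : measurable_fun setT g.
Proof. exact: (@measurable_funP _ _ _ _ setT f). Qed.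

HB.instance Definition _ := isMeasurableFun.Build _ _ _ _ g measurable_g.

Definition Lclass_mfun : {mfun_ mu, T >-> measurableTypeR R} :=
  (\pi_({mfun_ mu, T >-> measurableTypeR R}) g)%qT.

Lemma Lclass_mfunE : (Lclass_mfun : T -> R) = f %[ae mu].
Proof.
have := @reprK _ {mfun_ mu, T >-> measurableTypeR R} Lclass_mfun.
by rewrite {2}/Lclass_mfun => /eqP; rewrite eqmodE => /asboolP.
Qed.

Lemma Lclass_finite : finite_norm mu p (Lclass_mfun : T -> R).
Proof.
rewrite /finite_norm (ae_eq_Lnorm _ _ Lclass_mfunE).
- exact: Lfunction_finite.
- exact: (@measurable_funP _ _ _ _ setT (repr Lclass_mfun)).
- exact: (@measurable_funP _ _ _ _ setT f).
Qed.

Definition Lclass : LspaceType mu p1 :=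
  LebesgueSpace.Pack
   (LebesgueSpace.Class (isFinLebesgue.Build _ _ _ _ _ p1 _ Lclass_finite)).

Lemma LclassE : (Lclass : T -> R) = f %[ae mu].
Proof. exact: Lclass_mfunE. Qed.
End class_of_function.

Lemma Lspace_eqP (F G : LspaceType mu p1) : (F : T -> R) = G %[ae mu] -> F = G.
Proof.
move=> FG.
have /eqP : (F == G :> {mfun_ mu, T >-> measurableTypeR R}).
  rewrite -[X in X == _]reprK -[X in _ == X]reprK eqmodE; exact/asboolP.
case: F G {FG} => [F [[hF]]] [G [[hG]]] /= FG.
by subst G; rewrite (Prop_irrelevance hF hG).
Qed.

Definition Lzero : LspaceType mu p1 := Lclass 0.
Definition Lopp (F : LspaceType mu p1) := Lclass (- Lspace_repr F).
Definition Ladd (F G : LspaceType mu p1) :=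
  Lclass (Lspace_repr F + Lspace_repr G).
Definition Lscale (a : R) (F : LspaceType mu p1) :=
  Lclass (a *: Lspace_repr F).

Lemma Lzero_ae : \forall x \ae mu, (Lzero : T -> R) x = 0.
Proof. by apply: (filterS _ (LclassE 0)) => x /(_ I) ->. Qed.
Lemma Lopp_ae F : \forall x \ae mu, (Lopp F : T -> R) x = - (F : T -> R) x.
Proof. by apply: (filterS _ (LclassE (- Lspace_repr F))) => x /(_ I) ->. Qed.
Lemma Ladd_ae F G :
  \forall x \ae mu, (Ladd F G : T -> R) x = (F : T -> R) x + (G : T -> R) x.
Proof.
by apply: (filterS _ (LclassE (Lspace_repr F + Lspace_repr G))) => x /(_ I) ->.
Qed.
Lemma Lscale_ae a F :
  \forall x \ae mu, (Lscale a F : T -> R) x = a * (F : T -> R) x.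
Proof.
by apply: (filterS _ (LclassE (a *: Lspace_repr F))) => x /(_ I) ->.
Qed.

Let aeapp (P Q : T -> Prop) :
  {ae mu, forall x, P x} -> {ae mu, forall x, P x -> Q x} ->
  {ae mu, forall x, Q x}.
Proof. by move=> HP HPQ; apply: filter_app HPQ _. Qed.

Lemma LaddA : associative Ladd.
Proof.
move=> F G H; apply: Lspace_eqP.
apply: aeapp (Ladd_ae F G) _; apply: aeapp (Ladd_ae (Ladd F G) H) _.
apply: aeapp (Ladd_ae G H) _; apply: aeapp (Ladd_ae F (Ladd G H)) _.
apply: aeW => x FGH GH FGH' FG _; apply: etrans FGH _.
apply: etrans (congr1 (+%R _) GH) _; apply: etrans (addrA _ _ _) _.
by apply: esym; apply: etrans FGH' _; exact: (congr1 (+%R^~ _) FG).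
Qed.

Lemma LaddC : commutative Ladd.
Proof. by move=> F G; rewrite /Ladd addrC. Qed.

Lemma Ladd0 : left_id Lzero Ladd.
Proof.
move=> F; apply: Lspace_eqP.
apply: aeapp Lzero_ae _; apply: aeapp (Ladd_ae Lzero F) _.
by apply: aeW => x -> -> _; rewrite add0r.
Qed.

Lemma LaddN : left_inverse Lzero Lopp Ladd.
Proof.
move=> F; apply: Lspace_eqP.
apply: aeapp Lzero_ae _; apply: aeapp (Lopp_ae F) _.
apply: aeapp (Ladd_ae (Lopp F) F) _.
by apply: aeW => x -> -> -> _; rewrite addNr.
Qed.

HB.instance Definition _ := gen_eqMixin (LspaceType mu p1).
HB.instance Definition _ := gen_choiceMixin (LspaceType mu p1).
HB.instance Definition _ :=
  GRing.isZmodule.Build (LspaceType mu p1) LaddA LaddC Ladd0 LaddN.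

Lemma LscaleA a b F : Lscale a (Lscale b F) = Lscale (a * b) F.
Proof.
apply: Lspace_eqP.
apply: aeapp (Lscale_ae (a * b) F) _; apply: aeapp (Lscale_ae b F) _.
apply: aeapp (Lscale_ae a (Lscale b F)) _.
apply: aeW => x abF bF abF' _; apply: etrans abF _.
apply: etrans (congr1 ( *%R a) bF) _; apply: etrans (mulrA _ _ _) _.
exact: esym abF'.
Qed.

Lemma Lscale1 : left_id 1 Lscale.
Proof.
move=> F; apply: Lspace_eqP; apply: aeapp (Lscale_ae 1 F) _.
by apply: aeW => x -> _; rewrite mul1r.
Qed.

Lemma LscaleDr : right_distributive Lscale +%R.
Proof.
move=> a F G; apply: Lspace_eqP.
apply: aeapp (Lscale_ae a F) _; apply: aeapp (Lscale_ae a G) _.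
apply: aeapp (Ladd_ae (Lscale a F) (Lscale a G)) _.
apply: aeapp (Ladd_ae F G) _; apply: aeapp (Lscale_ae a (F + G)) _.
apply: aeW => x aFG FG aFaG aG aF _; apply: etrans aFG _.
apply: etrans (congr1 ( *%R a) FG) _; apply: etrans (mulrDr _ _ _) _.
by apply: esym; apply: etrans aFaG _; exact: (congr2 +%R aF aG).
Qed.

Lemma LscaleDl F : {morph Lscale^~ F : a b / a + b}.
Proof.
move=> a b; apply: Lspace_eqP.
apply: aeapp (Lscale_ae b F) _; apply: aeapp (Lscale_ae a F) _.
apply: aeapp (Ladd_ae (Lscale a F) (Lscale b F)) _.
apply: aeapp (Lscale_ae (a + b) F) _.
apply: aeW => x abF aFbF aF bF _; apply: etrans abF _.
apply: etrans (mulrDl _ _ _) _.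
by apply: esym; apply: etrans aFbF _; exact: (congr2 +%R aF bF).
Qed.

HB.instance Definition _ := GRing.Zmodule_isLmodule.Build R (LspaceType mu p1)
  LscaleA Lscale1 LscaleDr LscaleDl.

End Lspace_lmodule.

Section L2.
Context d (T : measurableType d) (R : realType).
Variable mu : {measure set T -> \bar R}.
Local Notation L2 := (LspaceType2 mu).

Definition L2dot (u v : L2) : R :=
  \int[mu]_x ((u : T -> R) x * (v : T -> R) x).

Definition L2norm (u : L2) : R := fine 'N[mu]_2[EFin \o (u : T -> R)]%E.

Definition constants : set L2 :=
  [set u | exists c : R, (u : T -> R) = cst c %[ae mu]].

(* The orthogonal projection of [u] onto [M], or 0 if there is none. *)
Definition orthproj (M : set L2) (u : L2) : L2 :=
  xget 0 [set v | M v /\ forall w, M w -> L2dot (u - v) w = 0].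

(* A linear operator defined on a subspace [odom] of L2; the values of [oapp]
   outside [odom] are irrelevant. *)
Record operator := Operator {
  odom : set L2;
  oapp :> L2 -> L2;
  odom0 : odom 0;
  odomP : forall (a : R) u v, odom u -> odom v -> odom (a *: u + v);
  oappP : forall (a : R) u v, odom u -> odom v ->
    oapp (a *: u + v) = a *: oapp u + oapp v }.

Implicit Type A : operator.

(* The second clause says that A and its adjoint have the same graph. *)
Definition self_adjoint A :=
  (forall u (e : R), 0 < e -> exists2 v, odom A v & L2norm (u - v) < e) /\
  forall u w, (forall v, odom A v -> L2dot (A v) u = L2dot v w) <->
              (odom A u /\ A u = w).

Definition nonneg_operator A := forall u, odom A u -> 0 <= L2dot (A u) u.

Definition compact_map (S : L2 -> L2) :=
  forall f : nat -> L2, (exists C : R, forall n, L2norm (f n) <= C) ->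
  exists (phi : nat -> nat) (v : L2), {homo phi : m n / (m < n)%N} /\
    (fun n => L2norm (S (f (phi n)) - v)) @ \oo --> 0.

(* [S] is the inverse of [A - z], a bijection from [odom A] onto L2. *)
Definition is_resolvent A (z : R) (S : L2 -> L2) :=
  (forall f, odom A (S f) /\ A (S f) - z *: S f = f) /\
  (forall u, odom A u -> S (A u - z *: u) = u).

Definition compact_resolvent A :=
  exists z S, is_resolvent A z S /\ compact_map S.

Definition op_eigenspace A (l : R) : set L2 :=
  [set u | odom A u /\ A u = l *: u].

Definition op_eigenvalue A (l : R) := exists2 u, u != 0 & op_eigenspace A l u.

(* The quadratic form of [A] is the closure of [u |-> <A u, u>]: its domain
   consists of the L2-limits of the sequences of [odom A] that are Cauchy for
   this form, and its values are the limits of the values on such sequences. *)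
Definition form_approx A (v : nat -> L2) (u : L2) :=
  [/\ forall n, odom A (v n),
      (fun n => L2norm (v n - u)) @ \oo --> 0 &
      forall e : R, 0 < e -> exists N, forall m n, (N <= m)%N -> (N <= n)%N ->
        `|L2dot (A (v m - v n)) (v m - v n)| < e].

Definition form_dom A : set L2 := [set u | exists v, form_approx A v u].

Definition form A (u : L2) : R :=
  get [set e | exists v, form_approx A v u /\
                 (fun n => L2dot (A (v n)) (v n)) @ \oo --> e].

Section spectral_decomposition.
Variables (A : operator) (ev : nat -> R).

Definition eigencomponent (k : nat) (u : L2) : L2 :=
  orthproj (op_eigenspace A (ev k)) u.

Definition L2variance (u : L2) : R := L2norm (u - eigencomponent 0%N u) ^+ 2.

Definition deficit (u : L2) : R := form A u - ev 1%N * L2variance u.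

Definition eigensum (m : nat) : set L2 :=
  [set Phi | exists v : nat -> L2,
     (forall k, (k <= m)%N -> op_eigenspace A (ev k) (v k)) /\
     Phi = \sum_(k < m.+1) v k].

Definition L2dist2 (u : L2) (M : set L2) : R :=
  inf [set L2norm (u - Phi) ^+ 2 | Phi in M].

Definition formdist2 (u : L2) (M : set L2) : R :=
  inf [set form A (u - Phi) | Phi in M].

Definition coefII (j : nat) : R := ev 1%N * ((ev j.-1)^-1 - (ev j)^-1).

Definition tail_sum (m : nat) (u : L2) (n : nat) : R :=
  \sum_(m.+1 <= k < n) (ev k - ev m) * L2norm (eigencomponent k u) ^+ 2.

Definition remainderI (m : nat) (u : L2) : R := limn (tail_sum m u).

Definition remainderII (m : nat) (u : L2) : R :=
  ev 1%N / ev m * limn (tail_sum m u).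

(* Partial sums over [2 <= j < n]. *)
Definition sumI (u : L2) (n : nat) : R :=
  \sum_(2 <= j < n) (ev j - ev j.-1) * L2dist2 u (eigensum j.-1).

Definition sumII (u : L2) (n : nat) : R :=
  \sum_(2 <= j < n) coefII j * formdist2 u (eigensum j.-1).

(* The inequalities obtained by dropping the remainders, with the last
   coefficient replaced by [C]. *)
Definition truncated_ineqI (m : nat) (C : R) :=
  forall u, form_dom A u ->
    sumI u m + C * L2dist2 u (eigensum m.-1) <= deficit u.

Definition truncated_ineqII (m : nat) (C : R) :=
  forall u, form_dom A u ->
    sumII u m + C * formdist2 u (eigensum m.-1) <= deficit u.

End spectral_decomposition.
End L2.
Arguments constants {d T R} mu _.

(* Main.v *)
Require Import Defs.
From mathcomp Require Import all_boot all_order all_algebra.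
From mathcomp Require Import all_classical all_reals all_analysis.
From mathcomp Require Import ring lra.

Set Implicit Arguments.
Unset Strict Implicit.
Unset Printing Implicit Defensive.

Import Order.TTheory GRing.Theory Num.Theory.
Import numFieldNormedType.Exports.

Local Open Scope classical_set_scope.
Local Open Scope ring_scope.

(** Let [u_k] be the component of [u] in the [k]-th eigenspace [E_k], let
[Q_m u = u - (u_0 + ... + u_m)], and put [V_m = |Q_m u|^2] and
[W_m = E(Q_m u)], where [E] is the quadratic form of [A].  As [Q_m u] is
orthogonal to [E_0 + ... + E_m], and [A] maps this sum into itself, Pythagoras
shows that [V_m] and [W_m] are the squared distances of [u] to that sum, in
norm and in energy (L2dist2_eigensum, formdist2_eigensum).  Moreover
[V_(m-1) = V_m + |u_m|^2] and [W_(m-1) = W_m + ev m |u_m|^2], while the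
deficit is [W_0 - ev 1 V_0].  Both identities are then Abel summations by
induction on [m]: the remainder of (I) is [W_m - ev m V_m], and that of (II) is
the same quantity multiplied by [ev 1 / ev m] (deficit_identityI,
deficit_identityII).

The analytic input is the min-max bound [ev (m+1) V_m <= W_m]
(form_lower_bound, tail_form_ge).  It makes the remainder at least
[(ev (m+1) - ev m) V_m], hence nonnegative, and zero only when [Q_m u = 0].
Together with [W_m <= E(u)] and [ev m -> +oo] it gives [V_m -> 0]; for [u] in
the operator domain it follows that [W_m = <Q_m u, A u> -> 0], and since this
domain is dense in the form domain for the energy, [W_m -> 0] for every [u]
(tail_form_cvg0).  This is the convergence of both series, and it identifies
the remainders with the sums over [k > m] of the statement (tail_sum_cvg).  An
eigenvector for [ev m] has zero remainder and positive distances to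
[E_0 + ... + E_(m-1)], so the last coefficients are optimal.

The min-max bound comes from the compact resolvent [S = (A - z)^-1], where [z]
may be any real number outside the spectrum.  A compact symmetric map whose
quadratic form takes a value [> g |f|^2], for some [g >= 0], on a closed
invariant subspace [N] has in [N] an eigenvector with eigenvalue [> g]
(compact_symmetric_eigenvalue).  For [L > z] let [N] be the orthogonal of all
eigenspaces of [A] with eigenvalue [< L].  Eigenvectors of [S] are eigenvectors
of [A], so the lemma for [S] and for [- S] gives
[0 <= <S f, f> <= |f|^2 / (L - z)] on [N], and Cauchy-Schwarz for the form of
[S] turns this into [<A w, w> >= L |w|^2].  The finitely many thresholds below
[z] follow by splitting off one eigencomponent at a time.

Limits in L2 are provided throughout by the compactness of [S]; in particular
each eigenspace is boundedly compact, which yields the orthogonal projections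
[u_k]. *)

(** * Real inequalities and limits *)

Section real_lemmas.
Context {R : realType}.

(** The abstract form of the Cauchy-Schwarz inequality: applied to
[t |-> B (u + t v, u + t v)] it serves for the scalar product, for the
quadratic form of the operator, and for the semidefinite forms attached to a
resolvent, which are nonnegative on a subspace only. *)
Lemma discriminant_le0 (a b c : R) : 0 <= c ->
  (forall t, 0 <= a + 2 * b * t + c * t ^+ 2) -> b ^+ 2 <= a * c.
Proof.
rewrite le_eqVlt => /predU1P[<-|c0] h.
  have [->|b0] := eqVneq b 0; first by rewrite expr0n mulr0.
  have := h (- (a + 1) / (2 * b)).
  rewrite mul0r addr0 mulrCA mulrA mulfK ?mulf_neq0 ?pnatr_eq0//; lra.
have := h (- b / c).
suff -> : a + 2 * b * (- b / c) + c * (- b / c) ^+ 2 = (a * c - b ^+ 2) / c.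
  by rewrite pmulr_lge0 ?invr_gt0// subr_ge0.
by field; rewrite gt_eqF.
Qed.

Lemma cvg0_le (f g : nat -> R) : (forall n, `|f n| <= g n) ->
  g @ \oo --> 0 -> f @ \oo --> 0.
Proof.
move=> fg g0; apply/norm_cvg0P.
apply: (squeeze_cvgr _ (cvg_cst (0 : R)) g0).
by apply: nearW => n; rewrite normr_ge0 fg.
Qed.

Lemma increasing_seq_cvgy (phi : nat -> nat) :
  {homo phi : m n / (m < n)%N} -> phi n @[n --> \oo] --> \oo.
Proof.
move=> h; have le n : (n <= phi n)%N.
  by elim: n => // n ih; exact: leq_ltn_trans ih (h _ _ (ltnSn n)).
move=> P [N _ NP]; exists N => // n /= Nn; apply: NP => /=.
exact: leq_trans Nn (le n).
Qed.

Lemma eq_limn_of_subr_cvg0 (s t : nat -> R) : cvgn s -> cvgn t ->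
  (fun n => s n - t n) @ \oo --> 0 -> limn s = limn t.
Proof.
move=> cs ct st; apply/eqP; rewrite -subr_eq0; apply/eqP.
exact: (cvg_unique (@Rhausdorff R) (cvgB cs ct) st).
Qed.

Lemma inf_attained (D : set R) (x : R) : D x -> (forall y, D y -> x <= y) -> inf D = x.
Proof.
move=> Dx lbx; apply/eqP; rewrite eq_le; apply/andP; split.
  by apply: (@ge_inf _ D) => //; exists x.
by apply: lb_le_inf; [exists x|].
Qed.

End real_lemmas.

(** * The scalar product of L2 *)

Section L2_inner_product.
Context d (T : measurableType d) (R : realType).
Variable mu : {measure set T -> \bar R}.
Local Notation L2 := (LspaceType2 mu).
Implicit Types u v w : L2.

Lemma L2mul_integrable u v :
  mu.-integrable setT (EFin \o ((u : T -> R) \* (v : T -> R))).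
Proof.
by apply/Lfun1_integrable/Lfun2_mul_Lfun1; exact: Lspace_in_Lfun.
Qed.

Lemma ae_eq_Rintegral (f g : T -> R) :
  mu.-integrable setT (EFin \o f) -> mu.-integrable setT (EFin \o g) ->
  (\forall x \ae mu, f x = g x) -> \int[mu]_x f x = \int[mu]_x g x.
Proof.
move=> /(measurable_int mu) mf /(measurable_int mu) mg fg.
congr fine; apply: ae_eq_integral => //.
by apply: filterS fg => x /= -> _.
Qed.

Lemma L2dotC u v : L2dot u v = L2dot v u.
Proof. by apply: eq_Rintegral => x _; rewrite mulrC. Qed.

Lemma L2dotDl u v w : L2dot (u + v) w = L2dot u w + L2dot v w.
Proof.
rewrite /L2dot -RintegralD ?measurableT//; [|exact: L2mul_integrable..].
apply: ae_eq_Rintegral; first exact: L2mul_integrable.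
  have := integrableD measurableT (L2mul_integrable u w) (L2mul_integrable v w).
  by apply: eq_integrable => // x _.
by apply: filterS (Ladd_ae u v) => x e; rewrite -mulrDl; congr (_ * _).
Qed.

Lemma L2dotZl a u w : L2dot (a *: u) w = a * L2dot u w.
Proof.
rewrite /L2dot -RintegralZl ?measurableT//; [|exact: L2mul_integrable..].
apply: ae_eq_Rintegral; first exact: L2mul_integrable.
  have := integrableZl measurableT a (L2mul_integrable u w).
  by apply: eq_integrable => // x _.
by apply: filterS (Lscale_ae a u) => x e; rewrite mulrA; congr (_ * _).
Qed.

Lemma L2dot_ge0 u : 0 <= L2dot u u.
Proof. by apply: Rintegral_ge0 => x _; rewrite -expr2 sqr_ge0. Qed.

Lemma L2dot_eq0 u : L2dot u u = 0 -> u = 0.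
Proof.
move=> u0; have iu := L2mul_integrable u u.
have : (\int[mu]_x `|(EFin \o ((u : T -> R) \* (u : T -> R))%R) x| = 0)%E.
  transitivity (\int[mu]_x (((u : T -> R) x * (u : T -> R) x)%R)%:E)%E.
    apply: eq_integral => x _ /=.
    by congr EFin; apply: ger0_norm; rewrite -expr2 sqr_ge0.
  rewrite -[LHS]fineK; last exact: integrable_fin_num iu.
  by rewrite [fine _]u0.
move=> /(ae_eq_integral_abs mu measurableT (measurable_int mu iu)) u2.
apply: Lspace_eqP; apply: filterS2 u2 (Lzero_ae mu (lee1n 2)) => x /= /(_ I) ux /= z _.
rewrite [RHS]z; move: ux => -[] /eqP.
by rewrite mulf_eq0 orbb => /eqP.
Qed.

Lemma sqr_L2norm u : L2norm u ^+ 2 = L2dot u u.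
Proof.
have fN : 'N[mu]_2[EFin \o (u : T -> R)]%E \is a fin_num.
  rewrite ge0_fin_numE ?Lnorm_ge0//.
  exact: (@Lebesgue_finite _ _ _ _ _ _ u).
have := @powR_Lnorm _ _ _ mu (EFin \o (u : T -> R)) 2.
rewrite pnatr_eq0 => /(_ isT) e.
rewrite /L2dot /Rintegral.
transitivity (fine ('N[mu]_2[EFin \o (u : T -> R)] `^ 2)%E).
  by rewrite -(fineK fN) /= powR_mulrn// fine_ge0// Lnorm_ge0.
rewrite e; congr fine; apply: eq_integral => x _ /=.
by rewrite powR_mulrn// -normrX ger0_norm ?sqr_ge0// expr2.
Qed.

Lemma L2norm_ge0 u : 0 <= L2norm u.
Proof. by rewrite fine_ge0// Lnorm_ge0. Qed.

End L2_inner_product.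

(** * Norm, convergence and orthogonal projection in L2 *)

Section L2_geometry.
Context d (T : measurableType d) (R : realType).
Variable mu : {measure set T -> \bar R}.
Local Notation L2 := (LspaceType2 mu).
Implicit Types (u v w : L2) (a : R).

Lemma L2dotDr u v w : L2dot u (v + w) = L2dot u v + L2dot u w.
Proof. by rewrite L2dotC L2dotDl !(L2dotC u). Qed.

Lemma L2dotZr a u w : L2dot u (a *: w) = a * L2dot u w.
Proof. by rewrite L2dotC L2dotZl L2dotC. Qed.

Lemma L2dotNl u w : L2dot (- u) w = - L2dot u w.
Proof. by rewrite -scaleN1r L2dotZl mulN1r. Qed.

Lemma L2dotNr u w : L2dot u (- w) = - L2dot u w.
Proof. by rewrite L2dotC L2dotNl L2dotC. Qed.

Lemma L2dot0l w : L2dot 0 w = 0.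
Proof. by rewrite -(scale0r (0 : L2)) L2dotZl mul0r. Qed.

Lemma L2dot0r w : L2dot w 0 = 0.
Proof. by rewrite L2dotC L2dot0l. Qed.

Definition L2dotE := (L2dotDl, L2dotDr, L2dotZl, L2dotZr, L2dotNl, L2dotNr).

Lemma L2norm0 : L2norm (0 : L2) = 0.
Proof. by apply/eqP; rewrite -sqrf_eq0 sqr_L2norm L2dot0l. Qed.

Lemma L2norm_eq0 u : L2norm u = 0 -> u = 0.
Proof. by move=> u0; apply: L2dot_eq0; rewrite -sqr_L2norm u0 expr0n. Qed.

Lemma L2normZ a u : L2norm (a *: u) = `|a| * L2norm u.
Proof.
apply/eqP; rewrite -(@eqrXn2 _ 2)// ?L2norm_ge0// ?mulr_ge0 ?L2norm_ge0//.
by rewrite exprMn !sqr_L2norm !L2dotE real_normK ?num_real// mulrA.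
Qed.

Lemma CauchySchwarz u v : `|L2dot u v| <= L2norm u * L2norm v.
Proof.
rewrite -(@ler_pXn2r _ 2) ?nnegrE ?mulr_ge0 ?L2norm_ge0//.
rewrite real_normK ?num_real// exprMn !sqr_L2norm.
apply: discriminant_le0; first exact: L2dot_ge0.
move=> t; have := L2dot_ge0 (u + t *: v); rewrite !L2dotE (L2dotC v u).
by rewrite (_ : _ + _ = L2dot u u + 2 * L2dot u v * t + L2dot v v * t ^+ 2)//; ring.
Qed.

Lemma ler_L2normD u v : L2norm (u + v) <= L2norm u + L2norm v.
Proof.
rewrite -(@ler_pXn2r _ 2) ?nnegrE ?addr_ge0 ?L2norm_ge0//.
rewrite sqrrD !sqr_L2norm !L2dotE (L2dotC v u).
have := le_trans (ler_norm _) (CauchySchwarz u v); lra.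
Qed.

Lemma L2normB u v : L2norm (u - v) = L2norm (v - u).
Proof. by rewrite -opprB -scaleN1r L2normZ normrN1 mul1r. Qed.

Definition L2cvg (f : nat -> L2) u := (fun n => L2norm (f n - u)) @ \oo --> 0.

Lemma L2cvg_cst u : L2cvg (fun=> u) u.
Proof. by rewrite /L2cvg subrr L2norm0; exact: cvg_cst. Qed.

Lemma L2cvgD (f g : nat -> L2) u v :
  L2cvg f u -> L2cvg g v -> L2cvg (fun n => f n + g n) (u + v).
Proof.
move=> fu gv; have h : (fun n => L2norm (f n - u) + L2norm (g n - v)) @ \oo --> 0.
  by rewrite -[0]addr0; exact: cvgD.
 apply: (cvg0_le _ h) => n.
rewrite ger0_norm ?L2norm_ge0// (_ : _ - _ = (f n - u) + (g n - v)).
  exact: ler_L2normD.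
by rewrite opprD addrACA.
Qed.

Lemma L2cvgZ a (f : nat -> L2) u : L2cvg f u -> L2cvg (fun n => a *: f n) (a *: u).
Proof.
move=> fu; have h : (fun n => `|a| * L2norm (f n - u)) @ \oo --> 0.
  by rewrite -(mulr0 `|a|); exact: cvgMl_tmp.
 apply: (cvg0_le _ h) => n.
by rewrite ger0_norm ?L2norm_ge0// -scalerBr L2normZ.
Qed.

Lemma L2cvg_dot (f g : nat -> L2) u v : L2cvg f u -> L2cvg g v ->
  (fun n => L2dot (f n) (g n)) @ \oo --> L2dot u v.
Proof.
move=> fu gv; apply/subr_cvg0.
have h : (fun n => L2norm (f n - u) * L2norm v + L2norm u * L2norm (g n - v) +
    L2norm (f n - u) * L2norm (g n - v)) @ \oo --> 0 * L2norm v + L2norm u * 0 + 0 * 0.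
  by apply: cvgD; [apply: cvgD; [exact: cvgMr_tmp | exact: cvgMl_tmp] | exact: cvgM].
rewrite !(mul0r, mulr0, addr0) in h; apply: (cvg0_le _ h) => n /=.
rewrite (_ : _ - _ = L2dot (f n - u) v + L2dot u (g n - v) +
  L2dot (f n - u) (g n - v)); last by rewrite !L2dotE; ring.
by rewrite (le_trans (ler_normD _ _))// lerD ?CauchySchwarz//
  (le_trans (ler_normD _ _))// lerD ?CauchySchwarz.
Qed.

Lemma L2cvg_unique (f : nat -> L2) u v : L2cvg f u -> L2cvg f v -> u = v.
Proof.
move=> fu fv; apply/eqP; rewrite -subr_eq0; apply/eqP/L2norm_eq0.
have h : (fun n => L2norm (f n - u) + L2norm (f n - v)) @ \oo --> 0.
  by rewrite -[0]addr0; exact: cvgD.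
apply/eqP; rewrite eq_le L2norm_ge0 andbT.
apply: ler_cvg_to (cvg_cst _) h _; apply: nearW => n.
rewrite (L2normB (f n)) (_ : u - v = (u - f n) + (f n - v)) ?ler_L2normD//.
by rewrite addrA subrK.
Qed.

(** For a subspace this amounts to finite dimension, but it is read off the
compactness of a resolvent directly. *)
Definition boundedly_compact (M : set L2) :=
  forall f : nat -> L2, (forall n, M (f n)) ->
  (exists C : R, forall n, L2norm (f n) <= C) ->
  exists (phi : nat -> nat) v,
    [/\ {homo phi : m n / (m < n)%N}, M v & L2cvg (f \o phi) v].

Definition subspace (M : set L2) := M 0 /\
  forall a u v, M u -> M v -> M (a *: u + v).

(** A minimizing sequence for the distance from [u] to [M] is bounded, so
a subsequence converges in [M]; the first variation at the minimizer gives
orthogonality. *)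
Lemma orthproj_exists (M : set L2) u : subspace M -> boundedly_compact M ->
  exists2 v, M v & forall w, M w -> L2dot (u - v) w = 0.
Proof.
move=> [M0 Mlin] cptM.
pose D := [set L2dot (u - w) (u - w) | w in M].
have D0 : has_inf D.
  split; first by exists (L2dot (u - 0) (u - 0)); exists 0.
  by exists 0 => _ [w _ <-]; exact: L2dot_ge0.
have /(_ _)/cid2 wP n : exists2 w, M w & L2dot (u - w) (u - w) < inf D + n.+1%:R^-1.
  have [] := @inf_adherent _ D n.+1%:R^-1 _ D0; first by rewrite invr_gt0.
  by move=> _ [w Mw <-] h; exists w.
pose w n := s2val (wP n).
have Mw n : M (w n) by exact: s2valP (wP n).
have wD n : L2dot (u - w n) (u - w n) < inf D + n.+1%:R^-1 by exact: s2valP' (wP n).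
have D_ge0 : 0 <= inf D by apply: lb_le_inf D0.1 _ => _ [z _ <-]; exact: L2dot_ge0.
have [|phi [v [hphi Mv wv]]] := cptM w Mw.
  exists (L2norm u + (inf D + 1)) => n.
  have -> : w n = u + - (u - w n) by rewrite opprB addrC subrK.
  rewrite (le_trans (ler_L2normD _ _))// lerD2l -scaleN1r L2normZ normrN1 mul1r.
  rewrite -(@ler_pXn2r _ 2) ?nnegrE ?addr_ge0 ?L2norm_ge0//.
  rewrite sqr_L2norm (le_trans (ltW (wD n)))//.
  have : n.+1%:R^-1 <= 1 :> R by rewrite invf_le1 ?ler1n.
  by move: D_ge0; move: (inf D) (_^-1) => x y x0 y1; rewrite sqrrD; have := sqr_ge0 x; lra.
exists v => // z Mz.
have vD : L2dot (u - v) (u - v) <= inf D.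
  have uv : L2cvg (fun n => u - w (phi n)) (u - v).
    have := L2cvgD (L2cvg_cst u) (L2cvgZ (-1) wv); rewrite scaleN1r.
    by under eq_fun do rewrite scaleN1r.
  have hh : (fun n => inf D + (phi n).+1%:R^-1) @ \oo --> inf D + 0.
    apply: cvgD; first exact: cvg_cst.
    exact: cvg_comp (increasing_seq_cvgy hphi) cvg_harmonic.
  rewrite -[leRHS]addr0; apply: ler_cvg_to (L2cvg_dot uv uv) hh _.
  by apply: nearW => n; exact/ltW/wD.
apply/eqP; rewrite -sqrf_eq0 eq_le sqr_ge0 andbT.
rewrite -(mul0r (L2dot z z)).
apply: discriminant_le0 => [|t]; first exact: L2dot_ge0.
have : inf D <= L2dot (u - (- t *: z + v)) (u - (- t *: z + v)).
  by apply: (ge_inf D0.2); exists (- t *: z + v) => //; exact: Mlin.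
move/(le_trans vD); rewrite -subr_ge0 opprD addrCA scaleNr opprK !L2dotE (L2dotC v z) (L2dotC u z) (L2dotC v u).
set X := (X in 0 <= X -> _); set Y := (Y in _ -> 0 <= Y).
by rewrite (_ : X = Y)// /X /Y; ring.
Qed.

End L2_geometry.

(** * Eigenvalues of compact symmetric maps *)

Section compact_symmetric_operator.
Context d (T : measurableType d) (R : realType).
Variable mu : {measure set T -> \bar R}.
Local Notation L2 := (LspaceType2 mu).
Implicit Types (u v w : L2) (a : R).

Lemma L2norm_normalize u : u != 0 -> L2norm ((L2norm u)^-1 *: u) = 1.
Proof.
move=> u0; rewrite L2normZ ger0_norm ?invr_ge0 ?L2norm_ge0// mulVf//.
by apply: contra u0 => /eqP /L2norm_eq0 ->.
Qed.

Variable S : L2 -> L2.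
Hypothesis S_linear : forall a u v, S (a *: u + v) = a *: S u + S v.
Hypothesis S_compact : compact_map S.

Let S0 : S 0 = 0.
Proof.
by apply: (addIr (S 0)); rewrite add0r -{1}(scale1r (S 0)) -S_linear scaler0 addr0.
Qed.

Let SZ a u : S (a *: u) = a *: S u.
Proof. by rewrite -[a *: u]addr0 S_linear S0 addr0. Qed.

(** Unit vectors with images of norm larger than [n] would have no subsequence
whose images converge. *)
Lemma compact_map_bounded : exists2 C : R, 0 <= C & forall u, L2norm (S u) <= C * L2norm u.
Proof.
apply: contrapT => unbounded.
have /(_ _)/cid fP (n : nat) : exists u, L2norm u = 1 /\ n%:R < L2norm (S u).
  apply: contrapT => /forallNP h; apply: unbounded; exists n%:R => // u.
  have [->|u0] := eqVneq u 0; first by rewrite S0 L2norm0 mulr0.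
  have := h ((L2norm u)^-1 *: u); rewrite L2norm_normalize// => /not_andP[//|/negP].
  have un0 : L2norm u != 0 by apply: contra u0 => /eqP /L2norm_eq0 ->.
  rewrite -leNgt SZ L2normZ ger0_norm ?invr_ge0 ?L2norm_ge0// mulrC.
  by rewrite ler_pdivrMr// lt_neqAle eq_sym un0 L2norm_ge0.
pose f n := sval (fP n).
have f1 n : L2norm (f n) = 1 by case: (svalP (fP n)).
have fS n : n%:R < L2norm (S (f n)) by case: (svalP (fP n)).
have [|phi [v [hphi]]] := S_compact (f := f).
  by exists 1 => n; rewrite f1.
move=> /cvgr_lt /(_ 1 ltr01) [N _ NP].
have [M _ MP] := increasing_seq_cvgy hphi (nbhs_infty_ger (1 + L2norm v)).
pose n := maxn N M.
have h1 := NP n (leq_maxl _ _); have h2 := MP n (leq_maxr _ _).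
have := ler_L2normD (S (f (phi n)) - v) v; rewrite subrK.
by have := fS (phi n); move: h1 h2 => /=; lra.
Qed.

(** The supremum [alpha] of the Rayleigh quotient [<S f, f> / |f|^2] on [N] is
the required eigenvalue.  A maximizing sequence of unit vectors satisfies
[alpha f - S f -> 0] by Cauchy-Schwarz for the semidefinite form of
[alpha - S]; compactness makes a subsequence of [S f] converge, and since
[alpha > g >= 0] the vectors [f] converge along it too, to an eigenvector. *)
Lemma compact_symmetric_eigenvalue (N : set L2) (g : R) f0 :
  (forall u v, L2dot (S u) v = L2dot u (S v)) ->
  subspace N -> (forall f v, (forall n, N (f n)) -> L2cvg f v -> N v) ->
  (forall u, N u -> N (S u)) ->
  0 <= g -> N f0 -> g * L2dot f0 f0 < L2dot (S f0) f0 ->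
  exists2 alpha, g < alpha & exists y, [/\ N y, y != 0 & S y = alpha *: y].
Proof.
move=> S_sym [N0 N_lin] N_closed N_inv g0 Nf0 gf0.
have NZ a u : N u -> N (a *: u) by move=> Nu; rewrite -[a *: u]addr0; exact: N_lin.
have [C C0 SC] := compact_map_bounded.
pose D := [set L2dot (S u) u | u in [set u | N u /\ L2norm u = 1]].
have f0_neq0 : f0 != 0.
  by apply/eqP => f00; move: gf0; rewrite f00 S0 !L2dot0l mulr0 ltxx.
have nf0 : 0 < L2norm f0.
  by rewrite lt_neqAle L2norm_ge0 eq_sym andbT; apply: contra f0_neq0 => /eqP /L2norm_eq0 ->.
have Df0 : D (L2dot (S f0) f0 / L2dot f0 f0).
  exists ((L2norm f0)^-1 *: f0); first by split; [exact: NZ|exact: L2norm_normalize].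
  rewrite SZ !L2dotE -sqr_L2norm; field; exact: lt0r_neq0.
have D_sup : has_sup D.
  split; first by eexists; exact: Df0.
  exists C => _ [u [_ u1] <-]; rewrite (le_trans (ler_norm _))//.
  by rewrite (le_trans (CauchySchwarz _ _))// u1 mulr1 -[C]mulr1 -u1 SC.
pose alpha := sup D.
have alpha_gt : g < alpha.
  apply: lt_le_trans (sup_upper_bound D_sup Df0).
  by rewrite ltr_pdivlMr// -sqr_L2norm exprn_gt0.
have alpha_gt0 : 0 < alpha by exact: le_lt_trans g0 alpha_gt.
exists alpha => //.
have rayleigh u : N u -> L2dot (S u) u <= alpha * L2dot u u.
  move=> Nu; have [->|u0] := eqVneq u 0; first by rewrite S0 !L2dot0l mulr0.
  have nu : 0 < L2norm u.
    by rewrite lt_neqAle L2norm_ge0 eq_sym andbT; apply: contra u0 => /eqP /L2norm_eq0 ->.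
  rewrite -ler_pdivrMr; last by rewrite -sqr_L2norm exprn_gt0.
  apply: (sup_upper_bound D_sup).
  exists ((L2norm u)^-1 *: u); first by split; [exact: NZ|exact: L2norm_normalize].
  rewrite SZ !L2dotE -sqr_L2norm; field; exact: lt0r_neq0.
have [B BE] : exists B : L2 -> L2, forall u, B u = alpha *: u - S u.
  by eexists => u.
have NB u : N u -> N (B u).
  by move=> Nu; rewrite BE -scaleN1r addrC; apply: N_lin; [exact: N_inv|exact: NZ].
(* Cauchy-Schwarz for the form <B u, v> on N, applied to u and B u, bounds
   |B u|^2 by the Rayleigh defect of u. *)
have B_small u : N u -> L2dot (B u) (B u) <= (alpha + C) * (alpha * L2dot u u - L2dot (S u) u).
  move=> Nu; have NBu := NB _ Nu; set q := (_ - L2dot (S u) u).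
  have q0 : 0 <= q by rewrite subr_ge0; exact: rayleigh.
  have psd : 0 <= alpha * L2dot (B u) (B u) - L2dot (S (B u)) (B u).
    by rewrite subr_ge0; exact: rayleigh.
  have cs : L2dot (B u) (B u) ^+ 2 <=
      q * (alpha * L2dot (B u) (B u) - L2dot (S (B u)) (B u)).
    apply: discriminant_le0 => // t.
    have := rayleigh _ (N_lin t _ _ NBu Nu).
    rewrite -subr_ge0 S_linear !L2dotE (S_sym u (B u)) (L2dotC (B u) u).
    rewrite (L2dotC u (S (B u))).
    have -> : L2dot (B u) (B u) = alpha * L2dot u (B u) - L2dot (S (B u)) u.
      by rewrite {1}BE !L2dotE S_sym (L2dotC u (S _)).
    by rewrite /q; set X := (X in 0 <= X -> _); set Y := (Y in _ -> 0 <= Y);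
      rewrite (_ : X = Y)// /X /Y; ring.
  have ub : alpha * L2dot (B u) (B u) - L2dot (S (B u)) (B u) <=
      (alpha + C) * L2dot (B u) (B u).
    rewrite mulrDl lerD2l -[leLHS]mulN1r.
    have : `|L2dot (S (B u)) (B u)| <= C * L2dot (B u) (B u).
      rewrite (le_trans (CauchySchwarz _ _))// -sqr_L2norm expr2 mulrA.
      by rewrite ler_wpM2r ?L2norm_ge0.
    by rewrite ler_norml => /andP[+ _]; lra.
  have [->|Bu0] := eqVneq (L2dot (B u) (B u)) 0.
    by rewrite mulr_ge0// addr_ge0// ltW.
  rewrite -(@ler_pM2r _ (L2dot (B u) (B u))); last by rewrite lt_neqAle eq_sym Bu0 L2dot_ge0.
  by rewrite -expr2 (le_trans cs)// mulrAC mulrC ler_wpM2r// mulrC.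
have /(_ _)/cid fP (n : nat) : exists u, [/\ N u, L2norm u = 1 &
    alpha - n.+1%:R^-1 < L2dot (S u) u].
  have [|_ [u [Nu u1] <-] h] := @sup_adherent _ D n.+1%:R^-1 _ D_sup.
    by rewrite invr_gt0.
  by exists u.
pose f n := sval (fP n).
have Nf n : N (f n) by case: (svalP (fP n)).
have f1 n : L2norm (f n) = 1 by case: (svalP (fP n)).
have fS n : alpha - n.+1%:R^-1 < L2dot (S (f n)) (f n) by case: (svalP (fP n)).
have [|phi [v [hphi Sfv]]] := S_compact (f := f).
  by exists 1 => n; rewrite f1.
have Bf0 : L2cvg (fun n => B (f (phi n))) 0.
  have h : (fun n => (alpha + C) * (phi n).+1%:R^-1) @ \oo --> (alpha + C) * 0.
    apply: cvgMl_tmp.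
    exact: cvg_comp (increasing_seq_cvgy hphi) (cvg_harmonic (R := R)).
  have h2 : (fun n => L2norm (B (f (phi n))) ^+ 2) @ \oo --> 0.
    rewrite mulr0 in h; apply: (cvg0_le _ h) => n.
    rewrite sqr_L2norm ger0_norm ?L2dot_ge0// (le_trans (B_small _ (Nf _)))//.
    rewrite ler_wpM2l ?addr_ge0 ?(ltW alpha_gt0)//.
    by rewrite -sqr_L2norm f1 expr1n mulr1 lerBlDr addrC -lerBlDr; exact/ltW/fS.
  have h3 : (fun n => Num.sqrt (L2norm (B (f (phi n))) ^+ 2)) @ \oo --> Num.sqrt (0 : R).
    by apply: continuous_cvg => //; exact: sqrt_continuous.
  rewrite sqrtr0 in h3; apply: (cvg0_le _ h3) => n.
  by rewrite subr0 sqrtr_sqr.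
pose y := alpha^-1 *: v.
have fy : L2cvg (f \o phi) y.
  have h := L2cvgZ alpha^-1 (L2cvgD Bf0 Sfv); rewrite add0r in h.
  apply: (cvg0_le _ h) => n /=; rewrite ger0_norm ?L2norm_ge0//.
  by rewrite BE subrK scalerA mulVf ?lt0r_neq0// scale1r.
exists y; split.
- by apply: N_closed fy => n; exact: Nf.
- apply/eqP => y0; have := L2cvg_dot fy fy; rewrite y0 L2dot0l.
  under eq_fun do rewrite /= -sqr_L2norm f1 expr1n.
  move=> h; suff : 1 <= 0 :> R by rewrite ler10.
  by apply: ler_cvg_to (cvg_cst (1 : R)) h _; exact: nearW.
- have -> : alpha *: y = v by rewrite scalerA divff ?lt0r_neq0// scale1r.
  apply: (L2cvg_unique _ Sfv).
  have h : (fun n => C * L2norm (f (phi n) - y)) @ \oo --> C * 0 by exact: cvgMl_tmp.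
  rewrite mulr0 in h; apply: (cvg0_le _ h) => n.
  rewrite ger0_norm ?L2norm_ge0//.
  suff -> : S (f (phi n)) - S y = S (f (phi n) - y) by exact: SC.
  by rewrite -(scaleN1r y) [_ + -1 *: y]addrC S_linear scaleN1r addrC.
Qed.

End compact_symmetric_operator.

(** * Lower bounds for the operator from its resolvent *)

Section spectral_gap.
Context d (T : measurableType d) (R : realType).
Variable mu : {measure set T -> \bar R}.
Local Notation L2 := (LspaceType2 mu).
Implicit Types (u v w e : L2) (a l : R).
Variable A : operator mu.
Hypothesis A_self_adjoint : self_adjoint A.

Lemma oapp0 : A 0 = 0.
Proof.
apply: (addIr (A 0)); rewrite add0r -{1}(scale1r (A 0)) -oappP; last 2 first.
- exact: odom0.
- exact: odom0.
by rewrite scaler0 addr0.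
Qed.

Lemma odomZ a u : odom A u -> odom A (a *: u).
Proof. by move=> Au; rewrite -[_ *: _]addr0; apply: odomP => //; exact: odom0. Qed.

Lemma odomD u v : odom A u -> odom A v -> odom A (u + v).
Proof. by move=> Au Av; rewrite -[u]scale1r; exact: odomP. Qed.

Lemma odomN u : odom A u -> odom A (- u).
Proof. by move=> Au; rewrite -scaleN1r; exact: odomZ. Qed.

Lemma odomB u v : odom A u -> odom A v -> odom A (u - v).
Proof. by move=> Au /odomN; exact: odomD. Qed.

Lemma oappD u v : odom A u -> odom A v -> A (u + v) = A u + A v.
Proof. by move=> Au Av; rewrite -[u]scale1r oappP// !scale1r. Qed.

Lemma oappZ a u : odom A u -> A (a *: u) = a *: A u.
Proof.
move=> Au; rewrite -[a *: u]addr0 oappP//; last exact: odom0.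
by rewrite oapp0 addr0.
Qed.

Lemma oappN u : odom A u -> A (- u) = - A u.
Proof. by move=> Au; rewrite -scaleN1r oappZ// scaleN1r. Qed.

Lemma oappB u v : odom A u -> odom A v -> A (u - v) = A u - A v.
Proof. by move=> Au Av; rewrite oappD ?oappN//; exact: odomN. Qed.

Lemma operator_symmetric u v : odom A u -> odom A v -> L2dot (A u) v = L2dot u (A v).
Proof.
by move=> Au Av; apply: ((A_self_adjoint.2 v (A v)).2 (conj Av erefl)).
Qed.

Lemma subspace_eigenspace l : subspace (op_eigenspace A l).
Proof.
split; first by split; [exact: odom0|rewrite oapp0 scaler0].
move=> a u v [Au Aul] [Av Avl]; split; first exact: odomP.
by rewrite oappP// Aul Avl scalerDr !scalerA mulrC.
Qed.

Lemma eigenspaceZ a l u : op_eigenspace A l u -> op_eigenspace A l (a *: u).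
Proof.
have [E0 EP] := subspace_eigenspace l.
by move=> Eu; rewrite -[_ *: _]addr0; exact: EP.
Qed.

Lemma eigenspaceD l u v :
  op_eigenspace A l u -> op_eigenspace A l v -> op_eigenspace A l (u + v).
Proof.
have [E0 EP] := subspace_eigenspace l.
by move=> Eu; rewrite -[u]scale1r; exact: EP.
Qed.

(** Self-adjointness identifies the domain of [A] with that of its adjoint, so it
suffices to pass to the limit in [<A w, f n> = <w, l f n>] with [w] fixed. *)
Lemma eigenspace_closed l (f : nat -> L2) v :
  (forall n, op_eigenspace A l (f n)) -> L2cvg f v -> op_eigenspace A l v.
Proof.
move=> Ef fv; apply: (A_self_adjoint.2 v (l *: v)).1 => w Aw.
have h := L2cvg_dot (L2cvg_cst (A w)) fv.
apply: (cvg_unique (@Rhausdorff R) h).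
have -> : (fun n => L2dot (A w) (f n)) = (fun n => L2dot w (l *: f n)).
  by apply/funext => n; have [Afn <-] := Ef n; exact: operator_symmetric.
exact: L2cvg_dot (L2cvg_cst w) (L2cvgZ l fv).
Qed.

Lemma eigenspace_orth l l' u v : l != l' ->
  op_eigenspace A l u -> op_eigenspace A l' v -> L2dot u v = 0.
Proof.
move=> ll' [Au Eu] [Av Ev]; have := operator_symmetric Au Av.
rewrite Eu Ev !L2dotE => /eqP; rewrite -subr_eq0 -mulrBl mulf_eq0 subr_eq0.
by rewrite (negbTE ll') => /eqP.
Qed.

Section resolvent.
Variables (z : R) (S : L2 -> L2).
Hypothesis S_resolvent : is_resolvent A z S.

Lemma resolvent_linear a u v : S (a *: u + v) = a *: S u + S v.
Proof.
have [Su uE] := S_resolvent.1 u; have [Sv vE] := S_resolvent.1 v.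
rewrite -{1}uE -{1}vE -(S_resolvent.2 (a *: S u + S v)); last exact: odomP.
congr S; rewrite oappP// !scalerDr scalerN !scalerA opprD addrACA.
by rewrite [z * a]mulrC.
Qed.

Lemma resolvent_symmetric u v : L2dot (S u) v = L2dot u (S v).
Proof.
have [Su uE] := S_resolvent.1 u; have [Sv vE] := S_resolvent.1 v.
by rewrite -{2}uE -{1}vE !L2dotE operator_symmetric.
Qed.

Lemma resolvent_eigenspace l u : op_eigenspace A l u -> u = (l - z) *: S u.
Proof.
move=> [Au Eu]; rewrite -{1}(S_resolvent.2 _ Au) Eu -scalerBl.
rewrite -[_ *: u in LHS]addr0 resolvent_linear -[X in _ = X]addr0; congr (_ + _).
by apply: (addIr (S 0)); rewrite -{1}(scale1r (S 0)) -resolvent_linear scaler0 addr0 add0r.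
Qed.

Hypothesis S_compact : compact_map S.

(** On the eigenspace of [l], the identity is [(l - z)] times the compact map
[S]. *)
Lemma boundedly_compact_eigenspace l : boundedly_compact (op_eigenspace A l).
Proof.
move=> f Ef /S_compact [phi [v [hphi Sv]]].
exists phi, ((l - z) *: v).
have fv : L2cvg (f \o phi) ((l - z) *: v).
  apply: (cvg0_le _ (L2cvgZ (l - z) Sv)) => n /=.
  by rewrite ger0_norm ?L2norm_ge0// -resolvent_eigenspace.
by split=> //; apply: eigenspace_closed fv => n; exact: Ef.
Qed.

(** The eigenvalues are selected by a condition and not by an index, so that the
bounds below hold for a self-adjoint operator whose eigenvalues have not been
enumerated. *)
Definition orthogonal_to (P : R -> Prop) : set L2 :=
  [set u | forall l, P l -> forall e, op_eigenspace A l e -> L2dot u e = 0].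

Lemma subspace_orthogonal_to P : subspace (orthogonal_to P).
Proof.
split=> [l _ e _|a u v Nu Nv l Pl e Ee]; first exact: L2dot0l.
by rewrite !L2dotE (Nu l)// (Nv l)// mulr0 addr0.
Qed.

Lemma orthogonal_to_closed P (f : nat -> L2) v :
  (forall n, orthogonal_to P (f n)) -> L2cvg f v -> orthogonal_to P v.
Proof.
move=> Nf fv l Pl e Ee; apply: (cvg_unique (@Rhausdorff R) (L2cvg_dot fv (L2cvg_cst e))).
have -> : (fun n => L2dot (f n) e) = cst 0 by apply/funext => n; exact: Nf Ee.
exact: cvg_cst.
Qed.

Lemma resolvent_orthogonal_to P u : orthogonal_to P u -> orthogonal_to P (S u).
Proof.
move=> Nu l Pl e Ee; rewrite resolvent_symmetric.
have [lz|lz] := eqVneq l z.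
  by move: (resolvent_eigenspace Ee); rewrite lz subrr scale0r => ->;
    rewrite -resolvent_symmetric L2dot0r.
have -> : S e = (l - z)^-1 *: e.
  by rewrite {2}(resolvent_eigenspace Ee) scalerA mulVf ?subr_eq0// scale1r.
by rewrite L2dotE (Nu _ Pl e Ee) mulr0.
Qed.

Lemma resolvent_eigenvector alpha y : y != 0 -> alpha != 0 -> S y = alpha *: y ->
  op_eigenspace A (z + alpha^-1) y.
Proof.
move=> y0 a0 Sy; have [Sdom SE] := S_resolvent.1 y.
have yE : y = alpha^-1 *: S y by rewrite Sy scalerA mulVf// scale1r.
split; first by rewrite yE; exact: odomZ.
rewrite {1}yE oappZ// -[A (S y)](subrK (z *: S y)) SE.
by rewrite scalerDr addrC Sy !scalerA -mulrA [z * _]mulrC mulrA mulVf// mul1r -scalerDl.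
Qed.

(** A value of [<S f, f>] outside these bounds would produce, in the orthogonal of
the eigenspaces below [L], an eigenvector of [S] with eigenvalue larger than
[(L - z)^-1], or negative.  It would be an eigenvector of [A] with eigenvalue
below [L], hence orthogonal to itself. *)
Lemma resolvent_form_bounds L f : z < L -> orthogonal_to (fun l => l < L) f ->
  0 <= L2dot (S f) f <= (L - z)^-1 * L2dot f f.
Proof.
move=> zL Nf; set N := orthogonal_to _ in Nf.
have Lz0 : 0 < L - z by rewrite subr_gt0.
have noeig l y : N y -> y != 0 -> op_eigenspace A l y -> L <= l.
  move=> Ny y0 Ey; rewrite leNgt; apply/negP => lL.
  by move/eqP: y0; apply; apply: L2dot_eq0; exact: (Ny _ lL).
have subN := subspace_orthogonal_to (fun l => l < L).
have NS u : N u -> N (S u) by exact: resolvent_orthogonal_to.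
have Nc := @orthogonal_to_closed (fun l => l < L).
apply/andP; split; rewrite leNgt; apply/negP => h.
- pose S' u := - S u.
  have S'lin a u v : S' (a *: u + v) = a *: S' u + S' v.
    by rewrite /S' resolvent_linear scalerN opprD.
  have S'cpt : compact_map S'.
    move=> g /S_compact [phi [v [hphi gv]]]; exists phi, (- v); split=> //.
    apply: (cvg0_le _ gv) => n; rewrite ger0_norm ?L2norm_ge0// L2normB.
    by rewrite /S' opprK addrC.
  have S'sym u v : L2dot (S' u) v = L2dot u (S' v).
    by rewrite /S' !L2dotE resolvent_symmetric.
  have S'N u : N u -> N (S' u).
    by move=> /NS NSu; rewrite /S' -scaleN1r -[_ *: _]addr0; apply: subN.2 => //; exact: subN.1.
  have [|alpha a0 [y [Ny y0 Sy]]] :=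
      compact_symmetric_eigenvalue S'lin S'cpt S'sym subN Nc S'N (lexx 0) Nf.
    by rewrite mul0r /S' L2dotE oppr_gt0.
  have Sy' : S y = - alpha *: y by rewrite scaleNr -Sy opprK.
  have := noeig _ _ Ny y0 (resolvent_eigenvector y0 _ Sy').
  rewrite oppr_eq0 (lt0r_neq0 a0) => /(_ isT); apply/negP; rewrite -ltNge.
  by rewrite (lt_trans _ zL)// invrN gtrDl oppr_lt0 invr_gt0.
- have [|alpha a0 [y [Ny y0 Sy]]] := compact_symmetric_eigenvalue
      resolvent_linear S_compact resolvent_symmetric subN Nc NS _ Nf h.
    by rewrite invr_ge0 ltW.
  have alpha0 : 0 < alpha by apply: lt_trans a0; rewrite invr_gt0.
  have := noeig _ _ Ny y0 (resolvent_eigenvector y0 (lt0r_neq0 alpha0) Sy).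
  apply/negP; rewrite -ltNge -ltrBrDl -[L - z]invrK ltf_pV2 ?posrE//.
  by rewrite invr_gt0.
Qed.

(** With [f = A w - z w], so that [w = S f], Cauchy-Schwarz for the form of [S]
gives [|w|^4 = <S f, w>^2 <= <S f, f> <S w, w> <= <w, f> |w|^2 / (L - z)]. *)
Lemma form_lower_bound_above L w : z < L -> odom A w ->
  orthogonal_to (fun l => l < L) w -> L * L2dot w w <= L2dot (A w) w.
Proof.
move=> zL Aw Nw; have [f fE] : exists f, f = A w - z *: w by eexists.
have Nf : orthogonal_to (fun l => l < L) f.
  move=> l lL e Ee; have [Ae Eel] := Ee.
  by rewrite fE !L2dotE operator_symmetric// Eel L2dotE (Nw _ lL e Ee) !mulr0 oppr0 addr0.
have Sf : S f = w by rewrite fE; exact: S_resolvent.2.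
have Lz0 : 0 < L - z by rewrite subr_gt0.
have bounds u := @resolvent_form_bounds L u zL.
have CS : L2dot w w ^+ 2 <= L2dot (S f) f * L2dot (S w) w.
  have /andP[Sw0 _] := bounds _ Nw.
  apply: discriminant_le0 => // t.
  have := (subspace_orthogonal_to (fun l => l < L)).2 t _ _ Nw Nf.
  move=> /bounds /andP[+ _]; rewrite resolvent_linear !L2dotE Sf.
  rewrite (resolvent_symmetric w f) Sf.
  by set X := (X in 0 <= X -> _); set Y := (Y in _ -> 0 <= Y);
    rewrite (_ : X = Y)// /X /Y; ring.
have {}CS : L2dot w w ^+ 2 <= L2dot w f * ((L - z)^-1 * L2dot w w).
  apply: le_trans CS _; have /andP[Sf0 _] := bounds _ Nf; rewrite Sf in Sf0.
  by rewrite Sf ler_wpM2l//; have /andP[] := bounds _ Nw.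
have [->|w0] := eqVneq w 0; first by rewrite !L2dot0r mulr0.
have ww0 : 0 < L2dot w w.
  by rewrite lt_neqAle L2dot_ge0 eq_sym andbT; apply: contra w0 => /eqP /L2dot_eq0 ->.
move: CS; rewrite expr2 mulrA ler_pM2r// ler_pdivlMr// mulrC mulrBl.
by rewrite fE !L2dotE [L2dot w (A w)]L2dotC lerD2r.
Qed.

End resolvent.
End spectral_gap.

(** * Spectral projections and the min-max bound *)

Section spectral_decomposition.
Context d (T : measurableType d) (R : realType).
Variable mu : {measure set T -> \bar R}.
Local Notation L2 := (LspaceType2 mu).
Implicit Types (u v w e : L2) (a l : R) (k m : nat).
Variables (A : operator mu) (ev : nat -> R).
Hypothesis A_self_adjoint : self_adjoint A.
Hypothesis A_compact_resolvent : compact_resolvent A.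
Hypothesis ev_increasing : forall i j, (i < j)%N -> ev i < ev j.
Hypothesis ev_spectrum : forall l : R, op_eigenvalue A l <-> exists k, l = ev k.
Hypothesis ev_infty : ev @ \oo --> +oo.

Local Notation E k := (op_eigenspace A (ev k)).
Local Notation comp := (eigencomponent A ev).

Lemma ev_neq i j : i != j -> ev i != ev j.
Proof.
by rewrite neq_ltn => /orP[] /ev_increasing h; rewrite ?(lt_eqF h)// (gt_eqF h).
Qed.

Lemma ev_le i j : (i <= j)%N -> ev i <= ev j.
Proof. by rewrite leq_eqVlt => /predU1P[->//|/ev_increasing/ltW]. Qed.

Lemma eigencomponentP k u : E k (comp k u) /\ forall e, E k e -> L2dot (u - comp k u) e = 0.
Proof.
have [z [S [Sres Scpt]]] := A_compact_resolvent.
have cptE : boundedly_compact (E k).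
  exact: boundedly_compact_eigenspace A_self_adjoint _ _ Sres Scpt _.
have [v Ev uv] := orthproj_exists u (subspace_eigenspace A (ev k)) cptE.
apply: (@xgetPex _ 0 [set v | E k v /\ forall w, E k w -> L2dot (u - v) w = 0]).
by exists v.
Qed.

Local Opaque eigencomponent.

Lemma eigencomponent_in k u : E k (comp k u). Proof. by case: (eigencomponentP k u). Qed.

Lemma dot_eigencomponent k u e : E k e -> L2dot (comp k u) e = L2dot u e.
Proof.
by case: (eigencomponentP k u) => _ h /h; rewrite !L2dotE => /eqP; rewrite subr_eq0 => /eqP.
Qed.

Lemma eigencomponent_unique k u v : E k v -> (forall e, E k e -> L2dot v e = L2dot u e) ->
  comp k u = v.
Proof.
move=> Ev h; apply/eqP; rewrite -subr_eq0; apply/eqP/L2dot_eq0.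
have Ed : E k (comp k u - v).
  rewrite -scaleN1r; apply: eigenspaceD; first exact: eigencomponent_in.
  exact: eigenspaceZ.
by rewrite !L2dotDl L2dotNl dot_eigencomponent// h// subrr.
Qed.

Lemma eigencomponent_linear k a u v : comp k (a *: u + v) = a *: comp k u + comp k v.
Proof.
apply: eigencomponent_unique => [|e Ee].
  exact: (subspace_eigenspace A (ev k)).2 (eigencomponent_in _ _) (eigencomponent_in _ _).
by rewrite !L2dotE; congr (_ * _ + _); exact: dot_eigencomponent.
Qed.

Definition spectral_proj m u : L2 := \sum_(k < m.+1) comp k u.
Definition spectral_tail m u : L2 := u - spectral_proj m u.
Local Notation P := spectral_proj.
Local Notation Q := spectral_tail.

Lemma spectral_tail0 u : Q 0 u = u - comp 0 u.
Proof. by rewrite /Q /P big_ord1. Qed.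

Lemma spectral_tailS m u : Q m u = Q m.+1 u + comp m.+1 u.
Proof. by rewrite /Q /P [in RHS]big_ord_recr/= opprD addrA subrK. Qed.

Lemma spectral_proj_linear m a u v : P m (a *: u + v) = a *: P m u + P m v.
Proof.
rewrite /P scaler_sumr -big_split /=; apply: eq_bigr => k _.
exact: eigencomponent_linear.
Qed.

Lemma spectral_tail_linear m a u v : Q m (a *: u + v) = a *: Q m u + Q m v.
Proof. by rewrite /Q spectral_proj_linear opprD addrACA scalerBr. Qed.

Lemma spectral_tailB m u v : Q m (u - v) = Q m u - Q m v.
Proof.
by rewrite addrC -scaleN1r spectral_tail_linear scaleN1r addrC.
Qed.

Definition orthogonal_upto m w := forall k, (k <= m)%N -> forall e, E k e -> L2dot w e = 0.

Lemma spectral_tail_orth m u : orthogonal_upto m (Q m u).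
Proof.
elim: m => [|m IH] k.
  rewrite leqn0 => /eqP -> e Ee.
  by rewrite spectral_tail0 !L2dotE dot_eigencomponent// subrr.
move=> km e Ee.
have projm j : (m < j)%N -> forall e', E j e' -> L2dot (P m u) e' = 0.
  move=> mj e' Ee'; rewrite /P.
  elim/big_ind: _ => [|x y x0 y0|i _]; first exact: L2dot0l.
    by rewrite L2dotDl x0 y0 addr0.
  apply: (eigenspace_orth A_self_adjoint) Ee'; last exact: eigencomponent_in.
  by rewrite ev_neq// neq_ltn (leq_trans _ mj)// ltn_ord.
have -> : Q m.+1 u = Q m u - comp m.+1 u by rewrite (spectral_tailS m u) addrK.
rewrite L2dotDl L2dotNl; move: km; rewrite leq_eqVlt => /predU1P[km|].
  rewrite {}km in Ee *.
  by rewrite /Q L2dotDl L2dotNl (projm m.+1)// dot_eigencomponent// oppr0 addr0 subrr.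
rewrite ltnS => km; rewrite (IH _ km)// sub0r.
rewrite (eigenspace_orth A_self_adjoint _ (eigencomponent_in m.+1 u) Ee) ?oppr0//.
by rewrite ev_neq// neq_ltn ltnS km orbT.
Qed.

Lemma eigensumP m Phi : eigensum A ev m Phi -> odom A Phi /\ eigensum A ev m (A Phi).
Proof.
move=> [v [Ev ->]].
suff [h1 h2] : odom A (\sum_(k < m.+1) v k) /\
    A (\sum_(k < m.+1) v k) = \sum_(k < m.+1) ev k *: v k.
  split=> //; exists (fun k => ev k *: v k); split=> // k km.
  exact/eigenspaceZ/Ev.
elim: m Ev => [|m IH] Ev; first by rewrite !big_ord1; exact: Ev.
rewrite !(big_ord_recr m.+1)/=.
have [h1 h2] := IH (fun k km => Ev k (leqW km)); have [h3 h4] := Ev m.+1 (leqnn _).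
by split; [exact: odomD|rewrite oappD// h2 h4].
Qed.

Lemma eigensumB m Phi Psi : eigensum A ev m Phi -> eigensum A ev m Psi ->
  eigensum A ev m (Phi - Psi).
Proof.
move=> [v [Ev ->]] [w [Ew ->]]; exists (fun k => v k - w k); split.
  move=> k km; rewrite -scaleN1r; apply: eigenspaceD; first exact: Ev.
  exact/eigenspaceZ/Ew.
by rewrite sumrB.
Qed.

Lemma eigensum_spectral_proj m u : eigensum A ev m (P m u).
Proof. by exists (fun k => comp k u); split=> // k _; exact: eigencomponent_in. Qed.

Lemma orthogonal_upto_eigensum m w Phi :
  orthogonal_upto m w -> eigensum A ev m Phi -> L2dot w Phi = 0.
Proof.
move=> wm [v [Ev ->]]; elim/big_ind: _ => [|x y x0 y0|i _].
- exact: L2dot0r.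
- by rewrite L2dotDr x0 y0 addr0.
- by have im : (i <= m)%N := ltn_ord i; apply: (wm i im); exact: Ev.
Qed.

Lemma eigensum_spectral_tail m u : eigensum A ev m u <-> Q m u = 0.
Proof.
split=> [um|/eqP].
  apply: L2dot_eq0; apply: (orthogonal_upto_eigensum (m := m)).
    exact: spectral_tail_orth.
  exact: eigensumB um (eigensum_spectral_proj m u).
by rewrite subr_eq0 => /eqP ->; exact: eigensum_spectral_proj.
Qed.

Lemma spectral_proj_dom m u : odom A (P m u).
Proof. by have [] := eigensumP (eigensum_spectral_proj m u). Qed.

Lemma spectral_tail_dom m u : odom A u -> odom A (Q m u).
Proof. by move=> Au; apply: odomB => //; exact: spectral_proj_dom. Qed.

(** For [ev m.+1 > z] this is the bound read off the resolvent.  It passes from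
[m.+1] to [m] by splitting off the component of [w] in the eigenspace of
[ev m.+1], on which the two sides agree. *)
Lemma form_lower_bound m w : odom A w -> orthogonal_upto m w ->
  ev m.+1 * L2dot w w <= L2dot (A w) w.
Proof.
have [z [S [Sres Scpt]]] := A_compact_resolvent.
have [M _ MP] : \forall n \near \oo, z < ev n.
  by move/cvgryPgt : ev_infty => /(_ z).
suff key n : forall m w, (M <= m.+1 + n)%N -> odom A w -> orthogonal_upto m w ->
    ev m.+1 * L2dot w w <= L2dot (A w) w by apply: (key M); rewrite leq_addl.
elim: n => [|n IH] {}m {}w Mm Aw wm.
  have zm : z < ev m.+1 by apply: MP; rewrite /= -(addn0 m.+1).
  apply: (form_lower_bound_above A_self_adjoint Sres Scpt zm Aw) => l lm e Ee.
  have [->|e0] := eqVneq e 0; first exact: L2dot0r.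
  have [k lk] := (ev_spectrum l).1 (ex_intro2 _ _ e e0 Ee).
  rewrite lk in lm Ee; apply: (wm k) Ee.
  by rewrite leqNgt; apply/negP => /ev_le; rewrite leNgt lm.
have Ec := eigencomponent_in m.+1 w; have [Ac Acl] := Ec.
set c := comp m.+1 w in Ec Ac Acl.
have [w' w'E] : exists w', w' = w - c by eexists.
have wE : w = w' + c by rewrite w'E subrK.
have Aw' : odom A w' by rewrite w'E; exact: odomB.
have w'c e : E m.+1 e -> L2dot w' e = 0.
  by move=> Ee; rewrite w'E L2dotDl L2dotNl dot_eigencomponent// subrr.
have w'm : orthogonal_upto m.+1 w'.
  move=> k; rewrite leq_eqVlt => /predU1P[-> //|km] e Ee.
  rewrite w'E L2dotDl L2dotNl (wm _ km)// (eigenspace_orth A_self_adjoint _ Ec Ee).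
    by rewrite subrr.
  by rewrite ev_neq// neq_ltn km orbT.
have := IH m.+1 w'; rewrite addSnnS => /(_ Mm Aw' w'm) hw'.
have -> : L2dot w w = L2dot w' w' + L2dot c c.
  by rewrite wE !L2dotE (L2dotC c w') (w'c c Ec) addr0 add0r.
have -> : L2dot (A w) w = L2dot (A w') w' + ev m.+1 * L2dot c c.
  rewrite wE oappD// Acl !L2dotE (L2dotC c w') (operator_symmetric A_self_adjoint Aw' Ac).
  by rewrite Acl L2dotE (w'c c Ec) !mulr0 addr0 add0r.
have := ev_le (leqnSn m.+1); have := L2dot_ge0 w'.
by rewrite mulrDr lerD2r => h1 h2; rewrite (le_trans _ hw')// ler_wpM2r.
Qed.

End spectral_decomposition.

(** * The closure of the quadratic form *)

Local Notation form := Defs.form.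

Section quadratic_form.
Context d (T : measurableType d) (R : realType).
Variable mu : {measure set T -> \bar R}.
Local Notation L2 := (LspaceType2 mu).
Implicit Types (u v w e : L2) (x y : nat -> L2).
Variable A : operator mu.
Hypothesis A_self_adjoint : self_adjoint A.
Hypothesis A_ge0 : nonneg_operator A.

Local Notation q u := (L2dot (A u) u).

Lemma qformD u v : odom A u -> odom A v -> q (u + v) = q u + 2 * L2dot (A u) v + q v.
Proof.
move=> Au Av; rewrite oappD// !L2dotE (operator_symmetric A_self_adjoint Av Au).
by rewrite (L2dotC v); ring.
Qed.

Lemma qformB u v : odom A u -> odom A v -> q (u - v) = q u - 2 * L2dot (A u) v + q v.
Proof.
move=> Au Av; rewrite qformD//; last exact: odomN.
by rewrite oappN// !L2dotNr L2dotNl; ring.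
Qed.

Lemma qform_CS u v : odom A u -> odom A v -> L2dot (A u) v ^+ 2 <= q u * q v.
Proof.
move=> Au Av; apply: discriminant_le0 => [|t]; first exact: A_ge0.
have Atv := odomZ t Av.
have := A_ge0 (odomD Au Atv); rewrite qformD// oappZ// !L2dotE.
set X := (X in 0 <= X -> _); set Y := (Y in _ -> 0 <= Y).
by rewrite (_ : X = Y)// /X /Y; ring.
Qed.

Lemma sqrt_qformD u v : odom A u -> odom A v ->
  Num.sqrt (q (u + v)) <= Num.sqrt (q u) + Num.sqrt (q v).
Proof.
move=> Au Av; have qu := A_ge0 Au; have qv := A_ge0 Av.
have quv := A_ge0 (odomD Au Av).
rewrite -(@ler_pXn2r _ 2) ?nnegrE ?addr_ge0 ?sqrtr_ge0// sqrrD !sqr_sqrtr//.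
rewrite qformD// -sqrtrM//; set b := L2dot (A u) v.
have : `|b| <= Num.sqrt (q u * q v) by rewrite -sqrtr_sqr ler_wsqrtr// qform_CS.
by rewrite ler_norml => /andP[_]; lra.
Qed.

Lemma sqrt_qform_dist u v : odom A u -> odom A v ->
  `|Num.sqrt (q u) - Num.sqrt (q v)| <= Num.sqrt (q (u - v)).
Proof.
move=> Au Av; have h1 := sqrt_qformD (odomB Au Av) Av.
have h2 := sqrt_qformD (odomB Av Au) Au; rewrite !subrK in h1 h2.
have e : q (u - v) = q (v - u).
  by rewrite -opprB oappN ?L2dotNl ?L2dotNr ?opprK//; exact: odomB.
by rewrite ler_norml lerBlDr h1 e lerNl opprB lerBlDr h2.
Qed.

Lemma qform_le2 u v : odom A u -> odom A v -> q (u - v) <= 2 * q u + 2 * q v.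
Proof.
move=> Au Av; have := A_ge0 (odomD Au Av).
by rewrite qformB// qformD//; lra.
Qed.

Lemma form_approxB x y u v : form_approx A x u -> form_approx A y v ->
  form_approx A (fun n => x n - y n) (u - v).
Proof.
move=> [Ax xu xC] [Ay yv yC]; split.
- by move=> n; exact: odomB.
- have := L2cvgD xu (L2cvgZ (-1) yv); rewrite scaleN1r.
  by under eq_fun do rewrite scaleN1r.
- move=> e e0; have e4 : 0 < e / 4 by rewrite divr_gt0.
  have [N hN] := xC _ e4; have [M hM] := yC _ e4.
  exists (maxn N M) => m n; rewrite !geq_max => /andP[Nm Mm] /andP[Nn Mn].
  rewrite (_ : _ - _ = (x m - x n) - (y m - y n)); last first.
    by rewrite !opprD !opprK addrACA.
  have A1 := odomB (Ax m) (Ax n); have A2 := odomB (Ay m) (Ay n).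
  rewrite ger0_norm; last by apply: A_ge0; exact: odomB.
  apply: le_lt_trans (qform_le2 A1 A2) _.
  have := hN m n Nm Nn; have := hM m n Mm Mn.
  by rewrite !ger0_norm; [lra|exact: A_ge0..].
Qed.

Lemma form_approx_cst u : odom A u -> form_approx A (fun=> u) u.
Proof.
move=> Au; split=> //; first exact: L2cvg_cst.
by move=> e e0; exists 0 => m n _ _; rewrite subrr L2dot0r normr0.
Qed.

(** For [n] and [m] large, [<A (x n - x m), x n - x m> < e] bounds
[<A x n, x n>] by [e + 2 <A x n, x m>]; let [m] tend to infinity. *)
Lemma qform_closable x : form_approx A x 0 -> (fun n => q (x n)) @ \oo --> 0.
Proof.
move=> [Ax x0 xC]; apply/cvgrPdist_le => e e0.
have [N hN] := xC _ e0; exists N => // n /= Nn.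
rewrite sub0r normrN ger0_norm; last exact: A_ge0.
have lim : (fun m => e + 2 * L2dot (A (x n)) (x m)) @ \oo --> e + 2 * L2dot (A (x n)) 0.
  apply: cvgD; first exact: cvg_cst.
  by apply: cvgMl_tmp; apply: L2cvg_dot x0; exact: L2cvg_cst.
rewrite L2dot0r mulr0 addr0 in lim.
apply: ler_cvg_to (cvg_cst (q (x n))) lim _.
exists N => // m /= Nm; have := ltW (hN n m Nn Nm).
have := A_ge0 (Ax m).
by rewrite ger0_norm; [rewrite qformB//; lra|apply: A_ge0; exact: odomB].
Qed.

Lemma sqrt_qform_cvg x u : form_approx A x u -> cvgn (fun n => Num.sqrt (q (x n))).
Proof.
move=> [Ax xu xC]; apply/cauchy_cvgP/cauchy_exP => e e0.
have [N hN] := xC _ (exprn_gt0 2 e0).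
exists (Num.sqrt (q (x N))); exists N => // n /= Nn; rewrite /ball /=.
apply: le_lt_trans (sqrt_qform_dist (Ax N) (Ax n)) _.
rewrite -(@ltr_pXn2r _ 2) ?nnegrE ?sqrtr_ge0 ?(ltW e0)//.
have h0 := A_ge0 (odomB (Ax N) (Ax n)); rewrite sqr_sqrtr//.
by have := hN N n (leqnn _) Nn; rewrite ger0_norm.
Qed.

(** The square root of [<A u, u>] is a seminorm, so its values along a Cauchy
sequence converge; by closability the limit depends on [u] alone.  This gives
access to the form, which is defined by choosing some approximation. *)
Lemma form_cvg x u : form_approx A x u -> (fun n => q (x n)) @ \oo --> form A u.
Proof.
have qcvg y v : form_approx A y v ->
    (fun n => q (y n)) @ \oo --> limn (fun n => Num.sqrt (q (y n))) ^+ 2.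
  move=> yv; have Ay : forall n, odom A (y n) by case: yv.
  have -> : (fun n => q (y n)) = (fun n => Num.sqrt (q (y n)) * Num.sqrt (q (y n))).
    by apply/funext => n; rewrite -expr2 sqr_sqrtr//; exact: A_ge0.
  by rewrite expr2; apply: cvgM; exact: sqrt_qform_cvg yv.
move=> xu; have [y [yu yl]] : [set l | exists y, form_approx A y u /\
    (fun n => q (y n)) @ \oo --> l] (form A u).
  by apply: getPex; eexists; exists x; split; [exact: xu|exact: qcvg xu].
(* Two approximations of u differ by an approximation of 0. *)
have d0 : (fun n => Num.sqrt (q (x n - y n))) @ \oo --> 0.
  have := form_approxB xu yu; rewrite subrr => /qform_closable.
  rewrite -{2}(sqrtr0 R) => h; apply: continuous_cvg h => //; exact: sqrt_continuous.
have lim : (fun n => Num.sqrt (q (x n)) - Num.sqrt (q (y n))) @ \oo --> 0.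
  apply: (cvg0_le _ d0) => n; apply: sqrt_qform_dist; first by case: xu.
  by case: yu.
have e := eq_limn_of_subr_cvg0 (sqrt_qform_cvg xu) (sqrt_qform_cvg yu) lim.
suff -> : form A u = limn (fun n => Num.sqrt (q (x n))) ^+ 2 by exact: qcvg xu.
by rewrite e; exact: (cvg_unique (@Rhausdorff R) yl (qcvg _ _ yu)).
Qed.

Lemma form_ge0 u : form_dom A u -> 0 <= form A u.
Proof.
move=> [x xu]; apply: ler_cvg_to (cvg_cst (0 : R)) (form_cvg xu) _.
by apply: nearW => n; apply: A_ge0; case: xu.
Qed.

Lemma form_odom u : odom A u -> form A u = q u.
Proof.
move=> Au; have h := form_cvg (form_approx_cst Au).
exact: (cvg_unique (@Rhausdorff R) h (cvg_cst _)).
Qed.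

Lemma form_dom_odom u : odom A u -> form_dom A u.
Proof. by move=> Au; exists (fun=> u); exact: form_approx_cst. Qed.

Lemma form_domB u v : form_dom A u -> form_dom A v -> form_dom A (u - v).
Proof. by move=> [x xu] [y yv]; eexists; exact: form_approxB xu yv. Qed.

Lemma formB u e : form_dom A u -> odom A e ->
  form A (u - e) = form A u - 2 * L2dot u (A e) + form A e.
Proof.
move=> [x xu] Ae; have Ax : forall n, odom A (x n) by case: xu.
have h := form_cvg (form_approxB xu (form_approx_cst Ae)).
apply: (cvg_unique (@Rhausdorff R) h) => {h}.
have -> : (fun n => q (x n - e)) = (fun n => q (x n) - 2 * L2dot (x n) (A e) + q e).
  apply/funext => n; rewrite qformB//; congr (_ - 2 * _ + _).
  exact: operator_symmetric.
have xu2 : L2cvg x u by case: xu.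
rewrite (form_odom Ae) /=; apply: cvgD; last exact: cvg_cst.
apply: (cvgB (form_cvg xu)); apply: cvgMl_tmp.
exact: L2cvg_dot xu2 (L2cvg_cst _).
Qed.

Lemma formD u e : form_dom A u -> odom A e ->
  form A (u + e) = form A u + 2 * L2dot u (A e) + form A e.
Proof.
move=> Du Ae; have := formB Du (odomN Ae).
rewrite opprK oappN// L2dotNr => ->.
rewrite (form_odom (odomN Ae)) (form_odom Ae).
by rewrite oappN// L2dotNl L2dotNr; ring.
Qed.

(** The parallelogram law, where the energy of [u - e] is dropped. *)
Lemma formD_le2 u e : form_dom A u -> odom A e ->
  form A (u + e) <= 2 * form A u + 2 * form A e.
Proof.
move=> Du Ae; have := form_ge0 (form_domB Du (form_dom_odom Ae)).
by rewrite (formB Du Ae) (formD Du Ae); lra.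
Qed.

(** The terms of an approximation of [u] converge to [u] in energy as well. *)
Lemma form_dense u (eps : R) : form_dom A u -> 0 < eps ->
  exists2 v, odom A v & form A (u - v) <= eps.
Proof.
move=> [x xu] e0; have [Ax _ /(_ _ e0)[N hN]] := xu.
exists (x N) => //.
apply: ler_cvg_to (form_cvg (form_approxB xu (form_approx_cst (Ax N)))) (cvg_cst eps) _.
exists N => // n /= Nn; have := ltW (hN n N Nn (leqnn _)).
exact: le_trans (ler_norm _).
Qed.

End quadratic_form.

(** * The deficit identities *)

Section deficit_identities.
Context d (T : measurableType d) (R : realType).
Variable mu : {measure set T -> \bar R}.
Local Notation L2 := (LspaceType2 mu).
Implicit Types (u v w e : L2) (a l : R) (k m n : nat).
Variables (A : operator mu) (ev : nat -> R).
Hypothesis A_self_adjoint : self_adjoint A.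
Hypothesis A_ge0 : nonneg_operator A.
Hypothesis A_compact_resolvent : compact_resolvent A.
Hypothesis ev0 : ev 0%N = 0.
Hypothesis ev_increasing : forall i j, (i < j)%N -> ev i < ev j.
Hypothesis ev_spectrum : forall l : R, op_eigenvalue A l <-> exists k, l = ev k.
Hypothesis ev_infty : ev @ \oo --> +oo.

Local Notation E k := (op_eigenspace A (ev k)).
Local Notation comp := (eigencomponent A ev).
Local Notation P := (spectral_proj A ev).
Local Notation Q := (spectral_tail A ev).
Local Notation q u := (L2dot (A u) u).

Local Opaque eigencomponent.

Let tail_orth m u : orthogonal_upto A ev m (Q m u).
Proof. exact: spectral_tail_orth. Qed.

Let in_comp k u : E k (comp k u).
Proof. exact: eigencomponent_in. Qed.

Let proj_sum m u : eigensum A ev m (P m u).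
Proof. exact: eigensum_spectral_proj. Qed.

Let proj_dom m u : odom A (P m u).
Proof. exact: spectral_proj_dom. Qed.

Lemma ev_gt0 k : (0 < k)%N -> 0 < ev k.
Proof. by move=> /ev_increasing; rewrite ev0. Qed.

Lemma orth_oapp_eigensum m w Phi :
  orthogonal_upto A ev m w -> eigensum A ev m Phi -> L2dot w (A Phi) = 0.
Proof. by move=> wm /eigensumP[_ APhi]; exact: orthogonal_upto_eigensum APhi. Qed.

Lemma L2dot_orthD m w Phi : orthogonal_upto A ev m w -> eigensum A ev m Phi ->
  L2dot (w + Phi) (w + Phi) = L2dot w w + L2dot Phi Phi.
Proof.
move=> wm PhiM; have w0 := orthogonal_upto_eigensum wm PhiM.
by rewrite !L2dotE (L2dotC Phi w) w0 addr0 add0r.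
Qed.

Lemma form_orthD m w Phi : form_dom A w -> orthogonal_upto A ev m w -> eigensum A ev m Phi ->
  form A (w + Phi) = form A w + form A Phi.
Proof.
move=> Dw wm PhiM; have [APhi _] := eigensumP PhiM.
by rewrite formD// (orth_oapp_eigensum wm PhiM) mulr0 addr0.
Qed.

Lemma spectral_decompE m u : u = Q m u + P m u.
Proof. by rewrite /spectral_tail subrK. Qed.

Lemma form_dom_tail m u : form_dom A u -> form_dom A (Q m u).
Proof. by move=> Du; apply: form_domB => //; apply: form_dom_odom => //; exact: proj_dom. Qed.

Lemma form_tail_le m u : form_dom A u -> form A (Q m u) <= form A u.
Proof.
move=> Du; have Dq := form_dom_tail m Du.
rewrite [in leRHS](spectral_decompE m u).
rewrite (form_orthD Dq (@tail_orth m u) (proj_sum m u)) lerDl.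
by apply: form_ge0 => //; apply: form_dom_odom => //; exact: proj_dom.
Qed.

Lemma L2norm_tail_le m u : L2norm (Q m u) <= L2norm u.
Proof.
rewrite -(@ler_pXn2r _ 2) ?nnegrE ?L2norm_ge0// !sqr_L2norm.
rewrite [in leRHS](spectral_decompE m u) (L2dot_orthD (@tail_orth m u) (proj_sum m u)).
by rewrite lerDl L2dot_ge0.
Qed.

Lemma spectral_tail_id m w : orthogonal_upto A ev m w -> Q m w = w.
Proof.
move=> wm; apply/esym/eqP; rewrite -subr_eq0; apply/eqP.
have e : w - Q m w = P m w by rewrite {1}(spectral_decompE m w) addrC addKr.
apply: L2dot_eq0; rewrite {2}e L2dotDl L2dotNl.
rewrite (orthogonal_upto_eigensum wm (proj_sum m w)).
by rewrite (orthogonal_upto_eigensum (@tail_orth m w) (proj_sum m w)) subrr.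
Qed.

(** Approximations of [w] need not be orthogonal to the first eigenspaces, but
their tails are; tails have smaller energy, and converge to the tail of [w],
which is [w]. *)
Lemma form_lower_bound_form_dom m w : form_dom A w -> orthogonal_upto A ev m w ->
  ev m.+1 * L2dot w w <= form A w.
Proof.
move=> [x xw] wm; have [Ax cvgx _] := xw.
have Qx : L2cvg (fun n => Q m (x n)) w.
  apply: (cvg0_le _ cvgx) => n; rewrite ger0_norm ?L2norm_ge0//.
  rewrite -{1}(spectral_tail_id wm) -spectral_tailB//.
  exact: L2norm_tail_le.
have lim : (fun n => ev m.+1 * L2dot (Q m (x n)) (Q m (x n))) @ \oo -->
    ev m.+1 * L2dot w w by apply: cvgMl_tmp; exact: L2cvg_dot.
apply: ler_cvg_to lim (form_cvg A_self_adjoint A_ge0 xw) _; apply: nearW => n.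
apply: (@le_trans _ _ (q (Q m (x n)))).
  by apply: form_lower_bound => //; exact: spectral_tail_dom.
rewrite -!form_odom//; last exact: spectral_tail_dom.
by apply: form_tail_le; exact: form_dom_odom.
Qed.

Definition tail_sqnorm m u : R := L2dot (Q m u) (Q m u).
Definition tail_form m u : R := form A (Q m u).
Local Notation V := tail_sqnorm.
Local Notation W := tail_form.

Lemma tail_sqnorm_ge0 m u : 0 <= V m u. Proof. exact: L2dot_ge0. Qed.

Lemma tail_form_ge0 m u : form_dom A u -> 0 <= W m u.
Proof. by move=> Du; apply: form_ge0 => //; exact: form_dom_tail. Qed.

Lemma eigensum_comp m u : eigensum A ev m (comp m u).
Proof.
exists (fun k => if k == m then comp m u else 0); split.
  move=> k _; case: eqP => [->|_]; first exact: in_comp.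
  by have [] := subspace_eigenspace A (ev k).
rewrite (bigD1 ord_max)//= eqxx big1 ?addr0// => i im.
by rewrite ifN//; apply: contra im => /eqP e; apply/eqP/val_inj.
Qed.

Lemma tail_sqnormS m u : V m u = V m.+1 u + L2norm (comp m.+1 u) ^+ 2.
Proof.
by rewrite /V (spectral_tailS _ _ m) (L2dot_orthD (@tail_orth m.+1 u) (eigensum_comp _ _))
  sqr_L2norm.
Qed.

Lemma tail_formS m u : form_dom A u ->
  W m u = W m.+1 u + ev m.+1 * L2norm (comp m.+1 u) ^+ 2.
Proof.
move=> Du; rewrite /W (spectral_tailS _ _ m).
rewrite (form_orthD (form_dom_tail _ Du) (@tail_orth m.+1 u) (eigensum_comp _ _)).
have [Ac Ec] := in_comp m.+1 u.
by rewrite (form_odom A_self_adjoint A_ge0 Ac) Ec L2dotZl sqr_L2norm.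
Qed.

Lemma tail_form0 u : form_dom A u -> W 0 u = form A u.
Proof.
move=> Du; rewrite [in RHS](spectral_decompE 0 u).
rewrite (form_orthD (form_dom_tail 0 Du) (@tail_orth 0 u) (proj_sum _ _)).
have [Ac Ec] := in_comp 0 u.
by rewrite /spectral_proj big_ord1 (form_odom A_self_adjoint A_ge0 Ac) Ec ev0 scale0r L2dot0l addr0.
Qed.

Lemma tail_form_ge m u : form_dom A u -> ev m.+1 * V m u <= W m u.
Proof.
by move=> Du; apply: form_lower_bound_form_dom; [exact: form_dom_tail|exact: tail_orth].
Qed.

(** From [ev m.+1 V_m <= W_m <= E(u)] and [ev m -> +oo]. *)
Lemma tail_sqnorm_cvg0 u : form_dom A u -> (fun m => V m u) @ \oo --> 0.
Proof.
move=> Du; apply/cvgrPdist_le => e e0.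
move/cvgryPgt : ev_infty => /(_ (form A u / e)) [N _ NP].
exists N => // m /= Nm; rewrite sub0r normrN ger0_norm ?tail_sqnorm_ge0//.
have := NP m.+1 (leq_trans Nm (leqnSn m)); rewrite /= ltr_pdivrMr// => h.
have ev1 : 0 < ev m.+1 by exact: ev_gt0.
rewrite -(ler_pM2l ev1) (le_trans (tail_form_ge m Du))//.
by rewrite (le_trans (form_tail_le m Du))// ltW.
Qed.

Lemma spectral_tail_cvg0 u : form_dom A u -> L2cvg (fun m => Q m u) 0.
Proof.
move=> Du; have h : (fun m => Num.sqrt (V m u)) @ \oo --> Num.sqrt (0 : R).
  by apply: continuous_cvg (tail_sqnorm_cvg0 Du); exact: sqrt_continuous.
rewrite sqrtr0 in h; apply: (cvg0_le _ h) => m.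
by rewrite subr0 /V -sqr_L2norm sqrtr_sqr.
Qed.

Lemma tail_form_odom_cvg0 v : odom A v -> (fun m => W m v) @ \oo --> 0.
Proof.
move=> Av; have Dv := form_dom_odom Av.
have h := L2cvg_dot (spectral_tail_cvg0 Dv) (L2cvg_cst (A v)).
rewrite L2dot0l in h.
suff -> : (fun m => W m v) = (fun m => L2dot (Q m v) (A v)) by exact: h.
apply/funext => m.
(* W_m v = <Q v, A Q v> = <Q v, A v>, because A (P v) is orthogonal to Q v. *)
have Aq : odom A (Q m v) by exact: spectral_tail_dom.
rewrite /W (form_odom A_self_adjoint A_ge0 Aq) (operator_symmetric A_self_adjoint Aq Aq).
rewrite {2}/spectral_tail (oappB Av (proj_dom _ _)) L2dotDr L2dotNr.
by rewrite (orth_oapp_eigensum (@tail_orth m v) (proj_sum m v)) subr0.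
Qed.

(** For [v] in the operator domain close to [u] in energy,
[W_m u <= 2 W_m (u - v) + 2 W_m v], where the first term is at most twice the
energy of [u - v], and the second tends to [0]. *)
Lemma tail_form_cvg0 u : form_dom A u -> (fun m => W m u) @ \oo --> 0.
Proof.
move=> Du; apply/cvgrPdist_le => e e0.
have [|v Av uv] := form_dense A_self_adjoint A_ge0 Du (eps := e / 4).
  by rewrite divr_gt0.
have Dv := form_dom_odom Av; have Duv := form_domB A_self_adjoint A_ge0 Du Dv.
have e4 : 0 < e / 4 by rewrite divr_gt0.
have /cvgrPdist_le /(_ _ e4) [N _ NP] := tail_form_odom_cvg0 Av.
exists N => // m /= Nm; rewrite sub0r normrN ger0_norm ?tail_form_ge0//.
have := NP m Nm; rewrite sub0r normrN ger0_norm ?tail_form_ge0// => Wv.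
have Wuv := le_trans (form_tail_le m Duv) uv.
have Aq : odom A (Q m v) by exact: spectral_tail_dom.
have Dq : form_dom A (Q m (u - v)) by exact: form_dom_tail.
have -> : W m u = form A (Q m (u - v) + Q m v).
  by rewrite /W; congr (form A _); rewrite spectral_tailB// subrK.
apply: le_trans (formD_le2 A_self_adjoint A_ge0 Dq Aq) _.
apply: le_trans (lerD (ler_wpM2l _ Wuv) (ler_wpM2l _ Wv)) _ => //.
by rewrite -mulrDr; lra.
Qed.

Lemma L2dist2_eigensum m u : L2dist2 u (eigensum A ev m) = V m u.
Proof.
apply: inf_attained => [|_ [Phi MPhi <-]].
  by exists (P m u) => //; rewrite sqr_L2norm.
have -> : u - Phi = Q m u + (P m u - Phi) by rewrite addrA -spectral_decompE.
rewrite sqr_L2norm (L2dot_orthD (@tail_orth m u) (eigensumB (proj_sum m u) MPhi)).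
by rewrite lerDl L2dot_ge0.
Qed.

Lemma formdist2_eigensum m u : form_dom A u -> formdist2 A u (eigensum A ev m) = W m u.
Proof.
move=> Du; apply: inf_attained => [|_ [Phi MPhi <-]]; first by exists (P m u).
have -> : u - Phi = Q m u + (P m u - Phi) by rewrite addrA -spectral_decompE.
have MP := eigensumB (proj_sum m u) MPhi.
rewrite (form_orthD (form_dom_tail m Du) (@tail_orth m u) MP) lerDl.
by apply: form_ge0 => //; apply: form_dom_odom => //; have [] := eigensumP MP.
Qed.

(** The closed form of the sum of [(ev k - ev m) |u_k|^2] over [k > m], see
[tail_sum_cvg]. *)
Definition spectral_remainder m u : R := W m u - ev m * V m u.
Local Notation rem := spectral_remainder.

Lemma spectral_remainder_ge m u : form_dom A u -> (ev m.+1 - ev m) * V m u <= rem m u.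
Proof. by move=> Du; rewrite mulrBl lerB// tail_form_ge. Qed.

Lemma spectral_remainder_ge0 m u : form_dom A u -> 0 <= rem m u.
Proof.
move=> Du; apply: le_trans (spectral_remainder_ge m Du).
by rewrite mulr_ge0 ?tail_sqnorm_ge0// subr_ge0 ltW// ev_increasing.
Qed.

Lemma spectral_remainder_eq0 m u : form_dom A u -> rem m u = 0 <-> eigensum A ev m u.
Proof.
move=> Du; rewrite (eigensum_spectral_tail A_self_adjoint A_compact_resolvent ev_increasing).
split=> [r0|Q0].
  have := spectral_remainder_ge m Du; rewrite r0 pmulr_rle0; last first.
    by rewrite subr_gt0 ev_increasing.
  by move=> V0; apply: L2dot_eq0; apply/eqP; rewrite eq_le V0 tail_sqnorm_ge0.
rewrite /rem /W /V Q0 L2dot0l mulr0 subr0 form_odom//; last exact: odom0.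
exact: L2dot0r.
Qed.

Lemma spectral_remainder_cvg0 u : form_dom A u -> (fun m => rem m u) @ \oo --> 0.
Proof.
move=> Du; apply: (cvg0_le _ (tail_form_cvg0 Du)) => m.
rewrite ger0_norm ?spectral_remainder_ge0// lerBlDr lerDl mulr_ge0 ?tail_sqnorm_ge0//.
by rewrite -ev0 (ev_le ev_increasing).
Qed.

Lemma tail_sumE m n u : form_dom A u ->
  tail_sum A ev m u (n + m.+1) = rem m u - (W (n + m) u - ev m * V (n + m) u).
Proof.
move=> Du; elim: n => [|n IH].
  by rewrite /tail_sum !add0n big_geq// subrr.
rewrite /tail_sum !addSn big_nat_recr/= ?leq_addl// -/(tail_sum A ev m u _) IH.
rewrite addnS (tail_formS (n + m) Du) (tail_sqnormS (n + m)); ring.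
Qed.

Lemma tail_sum_cvg m u : form_dom A u -> tail_sum A ev m u @ \oo --> rem m u.
Proof.
move=> Du; rewrite -(cvg_shiftn m.+1).
have -> : [sequence tail_sum A ev m u (n + m.+1)%N]_n =
    (fun n => rem m u - (W (n + m) u - ev m * V (n + m) u)).
  by apply/funext => n; exact: tail_sumE.
have hW : (fun n => W (n + m)%N u) @ \oo --> 0.
  by have := tail_form_cvg0 Du; rewrite -(cvg_shiftn m).
have hV : (fun n => V (n + m)%N u) @ \oo --> 0.
  by have := tail_sqnorm_cvg0 Du; rewrite -(cvg_shiftn m).
have h : (fun n => rem m u - (W (n + m) u - ev m * V (n + m) u)) @ \oo -->
    rem m u - (0 - ev m * 0).
  by apply: cvgB; [exact: cvg_cst|apply: (cvgB hW); exact: cvgMl_tmp].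
by rewrite mulr0 !subr0 in h.
Qed.

Lemma deficitE u : form_dom A u -> deficit A ev u = W 0 u - ev 1 * V 0 u.
Proof.
by move=> Du; rewrite /deficit /L2variance -spectral_tail0 sqr_L2norm tail_form0.
Qed.

Lemma deficit_identityI m u : form_dom A u ->
  deficit A ev u = sumI A ev u m.+2 + rem m.+1 u.
Proof.
move=> Du; rewrite deficitE//; elim: m => [|m IH].
  by rewrite /sumI big_geq// /rem (tail_formS 0 Du) (tail_sqnormS 0); ring.
rewrite IH /sumI [in RHS]big_nat_recr//= -/(sumI A ev u _) L2dist2_eigensum /rem.
by rewrite (tail_formS m.+1 Du) (tail_sqnormS m.+1); ring.
Qed.

Lemma deficit_identityII m u : form_dom A u ->
  deficit A ev u = sumII A ev u m.+2 + ev 1 / ev m.+1 * rem m.+1 u.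
Proof.
move=> Du; have ev_neq0 k : ev k.+1 != 0 by rewrite gt_eqF// ev_gt0.
rewrite deficitE//; elim: m => [|m IH].
  rewrite /sumII big_geq// /rem (tail_formS 0 Du) (tail_sqnormS 0).
  by field.
rewrite IH /sumII [in RHS]big_nat_recr//= -/(sumII A ev u _).
rewrite formdist2_eigensum// /coefII /= /rem.
rewrite (tail_formS m.+1 Du) (tail_sqnormS m.+1).
by field; rewrite !ev_neq0.
Qed.

Lemma coefII_gt0 j : (2 <= j)%N -> 0 < coefII ev j.
Proof.
case: j => [|[|j]]// _; rewrite mulr_gt0 ?ev_gt0// subr_gt0 ltf_pV2 ?posrE ?ev_gt0//.
exact: ev_increasing.
Qed.

Lemma sum_coefII k : (1 <= k)%N -> \sum_(2 <= j < k.+1) coefII ev j = 1 - ev 1 / ev k.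
Proof.
have ev_neq0 j : ev j.+1 != 0 by rewrite gt_eqF// ev_gt0.
case: k => // k _; elim: k => [|k IH]; first by rewrite big_geq// divff// subrr.
by rewrite big_nat_recr//= IH /coefII /=; field; rewrite !ev_neq0.
Qed.

Lemma nondecreasing_sumI u : nondecreasing_seq (sumI A ev u).
Proof.
apply/nondecreasing_seqP => n; rewrite /sumI.
have [n2|n2] := leqP 2 n; last by rewrite !big_geq// ltnW.
rewrite big_nat_recr//= lerDl L2dist2_eigensum mulr_ge0 ?tail_sqnorm_ge0//.
by rewrite subr_ge0 (ev_le ev_increasing)// leq_pred.
Qed.

Lemma nondecreasing_sumII u : form_dom A u -> nondecreasing_seq (sumII A ev u).
Proof.
move=> Du; apply/nondecreasing_seqP => n; rewrite /sumII.
have [n2|n2] := leqP 2 n; last by rewrite !big_geq// ltnW.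
rewrite big_nat_recr//= lerDl formdist2_eigensum// mulr_ge0 ?tail_form_ge0//.
exact/ltW/coefII_gt0.
Qed.

Lemma sumI_cvg u : form_dom A u -> sumI A ev u @ \oo --> deficit A ev u.
Proof.
move=> Du; rewrite -(cvg_shiftn 2).
have -> : [sequence sumI A ev u (n + 2)%N]_n = (fun n => deficit A ev u - rem n.+1 u).
  by apply/funext => n /=; rewrite addn2 (deficit_identityI n Du) addrK.
have h : (fun n => rem n.+1 u) @ \oo --> 0.
  by have := spectral_remainder_cvg0 Du; rewrite -cvg_shiftS.
by have := cvgB (cvg_cst (deficit A ev u)) h; rewrite subr0; exact.
Qed.

Lemma sumII_cvg u : form_dom A u -> sumII A ev u @ \oo --> deficit A ev u.
Proof.
move=> Du; rewrite -(cvg_shiftn 2).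
have -> : [sequence sumII A ev u (n + 2)%N]_n =
    (fun n => deficit A ev u - ev 1 / ev n.+1 * rem n.+1 u).
  by apply/funext => n /=; rewrite addn2 (deficit_identityII n Du) addrK.
suff h : (fun n => ev 1 / ev n.+1 * rem n.+1 u) @ \oo --> 0.
  by have := cvgB (cvg_cst (deficit A ev u)) h; rewrite subr0; exact.
have h : (fun n => rem n.+1 u) @ \oo --> 0.
  by have := spectral_remainder_cvg0 Du; rewrite -cvg_shiftS.
apply: (cvg0_le _ h) => n.
have ev1 := ev_gt0 (ltn0Sn 0); have evn := ev_gt0 (ltn0Sn n).
have c0 : 0 <= ev 1 / ev n.+1 by rewrite divr_ge0 ?(ltW ev1) ?(ltW evn).
rewrite ger0_norm; last by rewrite mulr_ge0 ?spectral_remainder_ge0.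
by rewrite ler_piMl ?spectral_remainder_ge0// ler_pdivrMr// mul1r (ev_le ev_increasing).
Qed.

(** An eigenvector for [ev m.+1] is its own tail of order [m], and lies in
[eigensum m.+1]. *)
Lemma eigenvector_extremal m : exists u,
  [/\ form_dom A u, rem m.+1 u = 0, 0 < V m u & 0 < W m u].
Proof.
have [u u0 Eu] : op_eigenvalue A (ev m.+1) by apply/ev_spectrum; exists m.+1.
have [Au Aul] := Eu; have Du := form_dom_odom Au.
have um : orthogonal_upto A ev m u.
  move=> k km e Ee; apply: (eigenspace_orth A_self_adjoint _ Eu Ee).
  by rewrite ev_neq// neq_ltn ltnS km orbT.
have uu : 0 < L2dot u u.
  by rewrite lt_neqAle L2dot_ge0 eq_sym andbT; apply: contra u0 => /eqP /L2dot_eq0 ->.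
exists u; split=> //.
- apply/spectral_remainder_eq0 => //.
  have -> : u = comp m.+1 u by apply/esym/eigencomponent_unique.
  exact: eigensum_comp.
- by rewrite /V spectral_tail_id.
- by rewrite /W spectral_tail_id// form_odom// Aul L2dotZl mulr_gt0// ev_gt0.
Qed.

End deficit_identities.

Theorem theorem2p4 (d : measure_display) (T : measurableType d) (R : realType)
    (mu : {finite_measure set T -> \bar R}) (A : operator mu)
    (A_self_adjoint : self_adjoint A) (A_ge0 : nonneg_operator A)
    (A_compact_resolvent : compact_resolvent A)
    (ev : nat -> R) (ev0 : ev 0%N = 0)
    (ev_increasing : forall i j, (i < j)%N -> ev i < ev j)
    (ev_spectrum : forall l : R, op_eigenvalue A l <-> exists k, l = ev k)
    (ev_infty : ev @ \oo --> +oo)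
    (E0_constants : op_eigenspace A (ev 0%N) = constants mu) :
  [/\ coefII ev 2%N = 1 - ev 1%N / ev 2%N,
      (forall k, (2 <= k)%N ->
        \sum_(2 <= j < k.+1) coefII ev j = 1 - ev 1%N / ev k),
      (forall u, form_dom A u -> forall m, (2 <= m)%N ->
        [/\ cvgn (tail_sum A ev m u),
            deficit A ev u =
              \sum_(2 <= j < m.+1)
                (ev j - ev j.-1) * L2dist2 u (eigensum A ev j.-1) +
              remainderI A ev m u,
            deficit A ev u =
              \sum_(2 <= j < m.+1)
                coefII ev j * formdist2 A u (eigensum A ev j.-1) +
              remainderII A ev m u,
            0 <= remainderI A ev m u /\ 0 <= remainderII A ev m u &
            (remainderI A ev m u = 0 <-> eigensum A ev m u) /\
            (remainderII A ev m u = 0 <-> eigensum A ev m u)]),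
      (forall u, form_dom A u ->
        [/\ nondecreasing_seq (sumI A ev u),
            sumI A ev u @ \oo --> deficit A ev u,
            nondecreasing_seq (sumII A ev u) &
            sumII A ev u @ \oo --> deficit A ev u]) &
      (forall m, (2 <= m)%N ->
        [/\ truncated_ineqI A ev m (ev m - ev m.-1),
            (forall C, ev m - ev m.-1 < C -> ~ truncated_ineqI A ev m C),
            truncated_ineqII A ev m (coefII ev m) &
            (forall C, coefII ev m < C -> ~ truncated_ineqII A ev m C)])].
Proof.
have pos k : (0 < k)%N -> 0 < ev k by move=> ?; rewrite -ev0; exact: ev_increasing.
split.
- have e1 : ev 1%N != 0 by rewrite gt_eqF// pos.
  have e2 : ev 2%N != 0 by rewrite gt_eqF// pos.
  by rewrite /coefII /=; field; rewrite e1 e2.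
- by move=> k k2; apply: sum_coefII => //; exact: ltnW.
- move=> u Du [|[|m]]// _.
  have cvg_tail : tail_sum A ev m.+2 u @ \oo --> spectral_remainder A ev m.+2 u.
    exact: tail_sum_cvg.
  have limE : limn (tail_sum A ev m.+2 u) = spectral_remainder A ev m.+2 u.
    by apply: cvg_lim.
  rewrite /remainderI /remainderII limE.
  have c0 : 0 < ev 1%N / ev m.+2 by rewrite divr_gt0// pos.
  have r0 : 0 <= spectral_remainder A ev m.+2 u by exact: spectral_remainder_ge0.
  split.
  + exact: cvg_tail.
  + exact: deficit_identityI.
  + exact: deficit_identityII.
  + by split=> //; rewrite mulr_ge0// ltW.
  + have r_eq0 : spectral_remainder A ev m.+2 u = 0 <-> eigensum A ev m.+2 u.
      exact: spectral_remainder_eq0.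
    split=> //; rewrite -r_eq0; split=> [/eqP|->]; last by rewrite mulr0.
    by rewrite mulf_eq0 (gt_eqF c0) => /eqP.
- move=> u Du; split.
  + exact: nondecreasing_sumI.
  + exact: sumI_cvg.
  + exact: nondecreasing_sumII.
  + exact: sumII_cvg.
- case=> [|[|m]]// _.
  have sumIS u : sumI A ev u m.+3 = sumI A ev u m.+2 +
      (ev m.+2 - ev m.+1) * L2dist2 u (eigensum A ev m.+1).
    by rewrite /sumI big_nat_recr.
  have sumIIS u : sumII A ev u m.+3 = sumII A ev u m.+2 +
      coefII ev m.+2 * formdist2 A u (eigensum A ev m.+1).
    by rewrite /sumII big_nat_recr.
  have idI u : form_dom A u ->
      deficit A ev u = sumI A ev u m.+3 + spectral_remainder A ev m.+2 u.
    exact: deficit_identityI.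
  have idII u : form_dom A u -> deficit A ev u = sumII A ev u m.+3 +
      ev 1%N / ev m.+2 * spectral_remainder A ev m.+2 u.
    exact: deficit_identityII.
  have [u [Du rem0 Vu Wu]] :
      exists u, [/\ form_dom A u, spectral_remainder A ev m.+2 u = 0,
        0 < tail_sqnorm A ev m.+1 u & 0 < tail_form A ev m.+1 u].
    exact: eigenvector_extremal.
  have Vd : L2dist2 u (eigensum A ev m.+1) = tail_sqnorm A ev m.+1 u.
    exact: L2dist2_eigensum.
  have Wd : formdist2 A u (eigensum A ev m.+1) = tail_form A ev m.+1 u.
    exact: formdist2_eigensum.
  split.
  + move=> v Dv; rewrite idI// sumIS lerDl; exact: spectral_remainder_ge0.
  + move=> C hC /(_ u Du); rewrite idI// sumIS rem0 addr0 lerD2l /= Vd ler_pM2r//.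
    by rewrite leNgt hC.
  + move=> v Dv; rewrite idII// sumIIS lerDl mulr_ge0//.
      by rewrite divr_ge0// ltW// pos.
    exact: spectral_remainder_ge0.
  + move=> C hC /(_ u Du); rewrite idII// sumIIS rem0 mulr0 addr0 lerD2l /= Wd ler_pM2r//.
    by rewrite leNgt hC.
Qed.
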